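(* Let $A_p\in\mathbb R^{n\times n}$, $b\in\mathbb R^n$, let $A_m\in\mathbb R^{n\times n}$ be Hurwitz, let $L\in\mathbb R^{n\times n}$ be such that $\bar A_m=A_m+L$ is Hurwitz, let $\Gamma=\Gamma^T>0$, and let $r:[0,\infty)\to\mathbb R$ be bounded. Consider the closed-loop adaptive system $$\dot x=A_px+bu,\qquad \dot x_m=A_mx_m+br-L(x-x_m),$$ $$u=\theta^Tx+r,\qquad \dot\theta=-\Gamma x e^TPb,\qquad e=x-x_m,$$ where $P=P^T>0$ solves $\bar A_m^TP+P\bar A_m=-I_{n\times n}$. Under the matching condition that there exists $\theta^*\in\mathbb R^n$ with $A_m=A_p+b\theta^{*T}$, this closed-loop adaptive system is globally stable with $e(t)$ tending to zero asymptotically.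
   Context: Here $x(t)\in\mathbb R^n$ is the plant state, $x_m(t)\in\mathbb R^n$ is the state of the (closed-loop) reference model, $\theta(t)\in\mathbb R^n$ is the adaptive control gain, $u(t)\in\mathbb R$ is the control input, $r(t)\in\mathbb R$ is the reference command, and $e(t)$ is the model following error. The matrix $A_p$ is unknown and $b$ is known. *)

(* Defs.v *)
From mathcomp Require Import all_boot all_order all_algebra.
From mathcomp Require Import complex.
From mathcomp Require Import all_classical all_reals all_analysis.

Set Implicit Arguments.
Unset Strict Implicit.
Unset Printing Implicit Defensive.

Import Order.TTheory GRing.Theory Num.Theory.
Import numFieldNormedType.Exports.

Local Open Scope classical_set_scope.
Local Open Scope ring_scope.

Definition hurwitz (R : realType) (n : nat) (A : 'M[R]_n) : Prop :=
  forall z : R[i],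
    eigenvalue (map_mx (real_complex R) A) z -> complex.Re z < 0.

Definition sym_posdef (R : realType) (n : nat) (A : 'M[R]_n) : Prop :=
  A^T = A /\ forall v : 'cV[R]_n, v != 0 -> 0 < (v^T *m A *m v) 0 0.

(* [ode_on T X F] means  dX/dt = F(t)  on [0, T[ in the sense of Caratheodory:
   X is the indefinite Lebesgue integral, component by component, of the locally
   integrable F.  This is the notion of solution that makes sense when the
   right-hand side involves a signal that need not be continuous; for a
   continuous F it is the classical one.  Values at t < 0 play no role. *)
Definition ode_on (R : realType) (n : nat) (T : \bar R)
    (X F : R -> 'cV[R]_n) : Prop :=
  forall t : R, 0 <= t -> (t%:E < T)%E -> forall i : 'I_n,
    (@lebesgue_measure R).-integrable `[0, t] (EFin \o (fun s => F s i 0)) /\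
    X t i 0 = X 0 i 0 + Rintegral (@lebesgue_measure R) `[0, t]
                                  (fun s => F s i 0).

Definition control (R : realType) (n : nat) (r : R -> R)
    (x theta : R -> 'cV[R]_n) (t : R) : R :=
  ((theta t)^T *m x t) 0 0 + r t.

(* [closed_loop Ap b Am L Gamma P r T x xm theta]: the signals x, xm, theta
   satisfy the closed-loop adaptive system on [0, T[. *)
Definition closed_loop (R : realType) (n : nat) (Ap : 'M[R]_n) (b : 'cV[R]_n)
    (Am L Gamma P : 'M[R]_n) (r : R -> R) (T : \bar R)
    (x xm theta : R -> 'cV[R]_n) : Prop :=
  let u := control r x theta in
  let e := fun t => x t - xm t in
  [/\ ode_on T x (fun t => Ap *m x t + u t *: b),
      ode_on T xm (fun t => Am *m xm t + r t *: b - L *m (x t - xm t)) &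
      ode_on T theta (fun t => - (Gamma *m x t *m (e t)^T *m P *m b))].

(* Global stability, for the equilibrium (e, theta) = (0, theta_star) of the
   error dynamics:
   - Lyapunov stability of that equilibrium;
   - for initial data of any size, all the signals, the control input included,
     are bounded; the bound depends neither on the solution nor on its interval
     of existence [0, T[;
   - no finite escape: every initial condition admits a solution on [0, +oo[.
   If r is not measurable the differential equations have no solution unless
   b = 0, whence the proviso in the last item. *)
Definition globally_stable (R : realType) (n : nat) (Ap : 'M[R]_n)
    (b : 'cV[R]_n) (Am L Gamma P : 'M[R]_n) (r : R -> R)
    (theta_star : 'cV[R]_n) : Prop :=
  [/\ forall eps : R, 0 < eps -> exists2 delta : R, 0 < delta &
        forall (T : \bar R) (x xm theta : R -> 'cV[R]_n),
          closed_loop Ap b Am L Gamma P r T x xm theta ->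
          `|x 0 - xm 0| < delta -> `|theta 0 - theta_star| < delta ->
          forall t : R, 0 <= t -> (t%:E < T)%E ->
            `|x t - xm t| < eps /\ `|theta t - theta_star| < eps,
      forall rho : R, exists C : R,
        forall (T : \bar R) (x xm theta : R -> 'cV[R]_n),
          closed_loop Ap b Am L Gamma P r T x xm theta ->
          `|x 0| <= rho -> `|xm 0| <= rho -> `|theta 0| <= rho ->
          forall t : R, 0 <= t -> (t%:E < T)%E ->
            [/\ `|x t| <= C, `|xm t| <= C, `|theta t| <= C
              & `|control r x theta t| <= C] &
      measurable_fun (`[0, +oo[ : set R) r ->
        forall x0 xm0 theta0 : 'cV[R]_n,
          exists x xm theta : R -> 'cV[R]_n,
            closed_loop Ap b Am L Gamma P r +oo%E x xm theta /\
            [/\ x 0 = x0, xm 0 = xm0 & theta 0 = theta0]].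

(* Main.v *)
(** The matching condition turns the error equation into
    [e' = (Am + L) e + ((theta - theta_star)^T x) b], in which the input [r] no
    longer appears, so that [e] is continuously differentiable even though [r]
    is merely bounded and measurable.  Along the solutions the energy
    [V = e^T P e + (theta - theta_star)^T Gamma^-1 (theta - theta_star)] has
    derivative [- e^T e]; hence the Lyapunov stability and the bounds on [e] and
    [theta].  The reference model is then a stable linear system driven by the
    bounded signal [r b - L e], so [xm] is bounded, and so are [x] and [u].
    As [e] is Lipschitz and the integral of [e^T e] is finite, [e] tends to 0
    (Barbalat).  Solutions exist globally because Picard iteration solves the
    system whose nonlinearity is evaluated at the clamped state, and the a priori
    bound shows that the clamp is never active. *)

Require Import Defs.
From mathcomp Require Import all_boot all_order all_algebra.
From mathcomp Require Import complex.
From mathcomp Require Import all_classical all_reals all_analysis.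
From mathcomp Require Import ring lra.

Set Implicit Arguments.
Unset Strict Implicit.
Unset Printing Implicit Defensive.

Import Order.TTheory GRing.Theory Num.Theory.
Import numFieldNormedType.Exports.

Local Open Scope classical_set_scope.
Local Open Scope ring_scope.

(** * Quadratic Lyapunov functions *)

(** Three constraints shape the proof. Only functions differentiable at every point of the interval
    considered are ever differentiated: [e] and [theta] qualify there, but with a merely measurable
    [r] neither [x] nor [xm] does. The energy is therefore handled by the mean value theorem, and
    the bound on [xm] needs a smoothing of its forcing term. Next, [P] certifies the decay of
    [Am + L], whereas [xm] is governed by [Am], of which only the spectrum is known; a second
    quadratic form has to be built from a triangular form over the complex numbers. Finally, no
    bound may depend on the horizon [T], because the existence proof applies the bounds on growing
    intervals before a global solution is known. Constants of the form [1 + a] arise from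
    [y ^+ 2 <= a], in place of square roots. *)

Lemma finite_pos_lower_bound (R : realFieldType) (I : finType) (f : I -> R) :
  (forall i, 0 < f i) -> exists2 m : R, 0 < m & forall i, m <= f i.
Proof.
move=> f_gt0; have s_gt0 : 0 < 1 + \sum_i (f i)^-1.
  by rewrite ltr_pwDl// sumr_ge0// => i _; rewrite invr_ge0 ltW.
(* This witness lies below every [f i] and also serves an empty [I], where there is no minimum to
   take. *)
exists (1 + \sum_i (f i)^-1)^-1; first by rewrite invr_gt0.
move=> i; rewrite -[leRHS]invrK lef_pV2 ?posrE ?invr_gt0//.
rewrite (bigD1 i)//= addrCA lerDl addr_ge0// sumr_ge0// => j _.
by rewrite invr_ge0 ltW.
Qed.

Definition bil (R : pzRingType) n (Q : 'M[R]_n) (u v : 'cV[R]_n) : R :=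
  (u^T *m Q *m v) 0 0.

Section Bilinear.
Variables (R : comNzRingType) (n : nat).
Implicit Types (Q : 'M[R]_n) (u v w : 'cV[R]_n).

Lemma bilE Q u v : bil Q u v = \sum_i \sum_j u i 0 * Q i j * v j 0.
Proof.
rewrite /bil -mulmxA mxE; apply: eq_bigr => i _.
by rewrite !mxE mulr_sumr; apply: eq_bigr => j _; rewrite mulrA.
Qed.

Lemma bilC Q u v : Q^T = Q -> bil Q u v = bil Q v u.
Proof.
move=> sQ; have -> : bil Q u v = (u^T *m Q *m v)^T 0 0 by rewrite mxE.
by rewrite !trmx_mul trmxK sQ mulmxA.
Qed.

Lemma bilDr Q u v w : bil Q u (v + w) = bil Q u v + bil Q u w.
Proof. by rewrite /bil mulmxDr mxE. Qed.

Lemma bilDl Q u v w : bil Q (u + v) w = bil Q u w + bil Q v w.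
Proof. by rewrite /bil linearD/= !mulmxDl mxE. Qed.

Lemma bilZr Q u a v : bil Q u (a *: v) = a * bil Q u v.
Proof. by rewrite /bil -scalemxAr mxE. Qed.

Lemma bilZl Q u a v : bil Q (a *: u) v = a * bil Q u v.
Proof. by rewrite /bil linearZ/= -!scalemxAl mxE. Qed.

Lemma bilNr Q u v : bil Q u (- v) = - bil Q u v.
Proof. by rewrite /bil mulmxN mxE. Qed.

Lemma bil1E u : bil 1%:M u u = \sum_i u i 0 ^+ 2.
Proof.
by rewrite /bil mulmx1 mxE; apply: eq_bigr => i _; rewrite mxE expr2.
Qed.

End Bilinear.

Section ComplexModulus.
Variable R : rcfType.
Local Open Scope complex_scope.

(** The norm of [R[i]] takes its values in [R[i]]; this brings it back to [R], where the estimates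
    are made. *)
Definition cnorm (z : R[i]) : R := complex.Re `|z|.

Lemma cnormE z : (cnorm z)%:C = `|z|.
Proof. by rewrite /cnorm RRe_real// normr_real. Qed.

Lemma cnorm_ge0 z : 0 <= cnorm z.
Proof. by rewrite -ler0c cnormE. Qed.

Lemma cnormM z w : cnorm (z * w) = cnorm z * cnorm w.
Proof. by apply: complexI; rewrite rmorphM/= !cnormE normrM. Qed.

Lemma cnormJ z : cnorm z^* = cnorm z.
Proof. by rewrite /cnorm normcJ. Qed.

Lemma Re_le_cnorm z : complex.Re z <= cnorm z.
Proof.
rewrite (le_trans (ler_norm _))// -lecR cnormE; exact: normc_ge_Re.
Qed.

Lemma Re_conjM z : complex.Re (z^* * z) = cnorm z ^+ 2.
Proof.
apply: complexI; rewrite rmorphXn/= cnormE sqr_normc mulrC RRe_real//.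
by rewrite ger0_real// mulcJ_ge0.
Qed.

Lemma ReD (z w : R[i]) : complex.Re (z + w) = complex.Re z + complex.Re w.
Proof. by case: z w => [? ?] [? ?]. Qed.

Lemma Re_sum (I : finType) (F : I -> R[i]) :
  complex.Re (\sum_i F i) = \sum_i complex.Re (F i).
Proof. by rewrite (big_morph _ ReD (erefl _)). Qed.

Lemma Re_realMl (a : R) z : complex.Re (a%:C * z) = a * complex.Re z.
Proof. by case: z => c d; rewrite /= mul0r subr0. Qed.

Lemma Re_realMr (a : R) z : complex.Re (z * a%:C) = complex.Re z * a.
Proof. by rewrite mulrC Re_realMl mulrC. Qed.

End ComplexModulus.

(* Schur's triangular form, with the off-diagonal entries made small by
   conjugating with diag(d ^ i) for a small d. *)
Lemma almost_diagonal (C : numClosedFieldType) n (A : 'M[C]_n) :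
  exists2 lam : 'I_n -> C, (forall i, eigenvalue A (lam i)) &
  forall eps : C, 0 < eps -> exists S B : 'M[C]_n,
    [/\ S \in unitmx, S *m A = B *m S, forall i, B i i = lam i &
        forall i j, i != j -> `|B i j| <= eps].
Proof.
case: n A => [|n] A.
  exists (fun=> 0) => [[]//|eps _]; exists 1%:M, A.
  by split; rewrite ?unitmx1 ?mul1mx ?mulmx1// => -[].
have [U Uu trig] := Schur A (ltn0Sn n).
have {}Uu := unitarymx_unit Uu.
move: trig; rewrite /similar_to conjumx//; set T := _ *m invmx U => trigT.
have UA : U *m A = T *m U by rewrite /T mulmxKV.
clearbody T.
(* The diagonal is fixed before [eps]: the construction of the Lyapunov form chooses [eps] from the
   real parts of these eigenvalues. *)
exists (fun i => T i i) => [i|eps eps_gt0].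
  have /eigenvalueP[v vT v0] : eigenvalue T (T i i).
    rewrite eigenvalue_root_char; apply/rootP.
    by rewrite char_poly_trig// horner_prod (bigD1 i)//= !hornerE subrr mul0r.
  apply/eigenvalueP; exists (v *m U).
    by rewrite -mulmxA UA mulmxA vT scalemxAl.
  apply: contra_neq v0 => /(congr1 (mulmx^~ (invmx U))).
  by rewrite mulmxK// mul0mx.
pose M := \sum_i \sum_j `|T i j|.
have M_ge0 : 0 <= M by apply: sumr_ge0 => i _; apply: sumr_ge0.
have Me_gt0 : 0 < M + eps by rewrite ltr_wpDl.
(* This makes [d <= 1] and [d * M <= eps]: an entry strictly below the diagonal gains a factor
   [d ^+ (i - j) <= d], so its modulus is at most [d * M]. *)
pose d := eps / (M + eps).
have d_gt0 : 0 < d by rewrite divr_gt0.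
have d_le1 : d <= 1 by rewrite ler_pdivrMr// mul1r lerDr.
have dM : d * M <= eps.
  by rewrite mulrAC ler_pdivrMr// ler_wpM2l ?ltW// ltrDl.
pose D := diag_mx (\row_(i < n.+1) d ^+ i).
(* The subtraction is truncated: above the diagonal the exponent is 0, harmlessly, since [T] is
   lower triangular. *)
pose B := \matrix_(i, j) (d ^+ (i - j) * T i j).
have DT : D *m T = B *m D.
  apply/matrixP => i j; rewrite mul_diag_mx mul_mx_diag !mxE.
  have [ij|ji] := ltnP i j; first by rewrite (is_trig_mxP trigT)// !(mulr0,mul0r).
  by rewrite mulrAC -exprD subnK.
exists (D *m U), B; split.
- rewrite unitmx_mul Uu andbT unitmxE det_diag unitfE; apply/prodf_neq0 => i _.
  by rewrite mxE expf_neq0// gt_eqF.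
- by rewrite -mulmxA UA !mulmxA DT.
- by move=> i; rewrite mxE subnn mul1r.
- move=> i j neq_ij; rewrite mxE normrM; have [ij|ji] := ltnP i j.
    by rewrite (is_trig_mxP trigT)// normr0 mulr0 ltW.
  have lt_ji : (j < i)%N by rewrite ltn_neqAle ji andbT eq_sym.
  rewrite (le_trans _ dM)// ler_pM//.
    rewrite normrX (ger0_norm (ltW d_gt0)) -(subnSK lt_ji) exprS.
    by rewrite ler_piMr ?(ltW d_gt0)// exprn_ile1// ltW.
  rewrite /M (bigD1 i)//= (bigD1 j)//= -addrA lerDl addr_ge0// sumr_ge0//.
  by move=> k _; apply: sumr_ge0.
Qed.

(* With an almost diagonal form [S A = B S], the form [|S v|^2] decreases along
   the flow of [A]; its real part on real vectors is the sought [Q]. *)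
Lemma lyapunov_form (R : rcfType) n (A : 'M[R]_n) :
  (forall z : R[i], eigenvalue (map_mx (real_complex R) A) z ->
     complex.Re z < 0) ->
  exists Q : 'M[R]_n, exists c : R,
    [/\ Q^T = Q, forall v : 'cV[R]_n, v != 0 -> 0 < bil Q v v, 0 < c &
        forall v : 'cV[R]_n, bil Q v (A *m v) <= - c * bil Q v v].
Proof.
move=> hA; set Ac := map_mx _ A in hA *.
have [lam lamE diagA] := almost_diagonal Ac.
have [m m_gt0 m_le] : exists2 m : R, 0 < m & forall i, m <= - complex.Re (lam i).
  by apply: finite_pos_lower_bound => i; rewrite oppr_gt0; exact/hA/lamE.
(* The diagonal contributes at most [- m * Y], with [Y] the sum of the squared moduli, and the
   off-diagonal terms at most [eps * n%:R * Y <= m / 2 * Y]; the rate [m / 2] remains. *)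
pose eps := m / (2 * (n%:R + 1)).
have n1_gt0 : 0 < n%:R + 1 :> R by rewrite ltr_wpDl.
have eps_gt0 : 0 < eps by rewrite divr_gt0// mulr_gt0.
have [|S [B [Su SA Bd Bo]]] := diagA (real_complex R eps); first by rewrite ltcR.
pose s (v : 'cV[R]_n) i := (S *m map_mx (real_complex R) v) i 0.
pose Q : 'M[R]_n :=
  \matrix_(j, k) complex.Re (\sum_i conjc (S i j) * S i k).
have QE u v : bil Q u v = \sum_i complex.Re (conjc (s u i) * s v i).
  rewrite bilE.
  transitivity (\sum_j \sum_k \sum_i
      complex.Re (conjc (S i j) * S i k) * (u j 0 * v k 0)).
    apply: eq_bigr => j _; apply: eq_bigr => k _; rewrite mxE Re_sum.
    by rewrite mulrAC mulrC mulr_suml.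
  under eq_bigr do rewrite exchange_big.
  rewrite exchange_big; apply: eq_bigr => i _ /=.
  rewrite /s !mxE rmorph_sum/= mulr_suml Re_sum; apply: eq_bigr => j _.
  rewrite mulr_sumr Re_sum; apply: eq_bigr => k _.
  by rewrite !mxE; case: (S i j) (S i k) => [? ?] [? ?] /=; ring.
have QvE v : bil Q v v = \sum_i cnorm (s v i) ^+ 2.
  by rewrite QE; apply: eq_bigr => i _; rewrite Re_conjM.
exists Q, (m / 2); split.
- apply/matrixP => j k; rewrite !mxE !Re_sum; apply: eq_bigr => i _.
  by case: (S i j) (S i k) => [a b] [c d] /=; ring.
- move=> v v0; rewrite lt_neqAle QvE sumr_ge0 ?andbT; last first.
    by move=> i _; exact: sqr_ge0.
  apply: contra_neqN v0; rewrite eq_sym psumr_eq0; last first.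
    by move=> i _; exact: sqr_ge0.
  move=> /allP s0; have : S *m map_mx (real_complex R) v = 0.
    apply/matrixP => i j; rewrite ord1 [RHS]mxE; apply/eqP.
    have := s0 i (mem_index_enum _); rewrite /= sqrf_eq0.
    by move=> /eqP y0; rewrite -normr_eq0 -cnormE y0 eqxx.
  move/(congr1 (mulmx (invmx S))); rewrite mulKmx// mulmx0 => /matrixP v0.
  by apply/matrixP => i j; have := v0 i j; rewrite !mxE => /complexI.
- by rewrite divr_gt0.
move=> v; rewrite QE QvE.
have sA i : s (A *m v) i = \sum_j B i j * s v j.
  by rewrite /s map_mxM mulmxA SA -mulmxA mxE.
pose y i := cnorm (s v i).
have term i : complex.Re (conjc (s v i) * s (A *m v) i) <=
    - m * y i ^+ 2 + \sum_j eps * ((y i ^+ 2 + y j ^+ 2) / 2).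
  rewrite sA mulr_sumr Re_sum (bigD1 i)//= [X in _ <= _ + X](bigD1 i)//=.
  have diag_le : complex.Re (conjc (s v i) * (B i i * s v i)) <= - m * y i ^+ 2.
    rewrite mulrCA -Re_conjM Bd.
    rewrite (_ : conjc (s v i) * s v i = (y i ^+ 2)%:C%C); last first.
      by rewrite rmorphXn/= cnormE sqr_normc mulrC.
    rewrite Re_realMr /= ler_wpM2r ?sqr_ge0// lerNr; exact: m_le.
  have off_le j : j != i -> complex.Re (conjc (s v i) * (B i j * s v j)) <=
      eps * ((y i ^+ 2 + y j ^+ 2) / 2).
    move=> ji; rewrite (le_trans (Re_le_cnorm _))// !cnormM cnormJ mulrCA.
    apply: ler_pM; rewrite ?mulr_ge0 ?cnorm_ge0//.
      by rewrite -lecR cnormE Bo// eq_sym.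
    have := sqr_ge0 (y i - y j); rewrite -/(y i) -/(y j); nra.
  rewrite lerD// -[leLHS]add0r lerD//.
    by rewrite mulr_ge0 ?(ltW eps_gt0)// divr_ge0// addr_ge0// sqr_ge0.
  by apply: ler_sum => j; exact: off_le.
rewrite (le_trans (ler_sum _ (fun i _ => term i)))// big_split/=.
set Y := \sum_i y i ^+ 2.
have Y_ge0 : 0 <= Y by apply: sumr_ge0 => i _; exact: sqr_ge0.
have -> : \sum_i \sum_j eps * ((y i ^+ 2 + y j ^+ 2) / 2) = eps * n%:R * Y.
  transitivity (\sum_(i < n) (eps / 2 * n%:R * y i ^+ 2 + eps / 2 * Y)).
    apply: eq_bigr => i _; rewrite -mulr_sumr -mulr_suml big_split/= -/Y.
    by rewrite sumr_const card_ord -mulr_natl; ring.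
  rewrite big_split/= -mulr_sumr -/Y sumr_const card_ord -mulr_natl.
  by field.
rewrite -mulr_sumr -/Y.
have epsE : eps * n%:R <= m / 2.
  rewrite /eps invfM mulrA -mulrA ler_piMr ?divr_ge0 ?(ltW m_gt0)//.
  by rewrite mulrC ler_pdivrMr// mul1r lerDl.
have := ler_wpM2r Y_ge0 epsE; rewrite -/Y.
lra.
Qed.

Section PositiveForms.
Variables (R : realFieldType) (n : nat) (Q : 'M[R]_n).
Hypotheses (symQ : Q^T = Q)
           (posQ : forall v : 'cV[R]_n, v != 0 -> 0 < bil Q v v).
Implicit Types u v : 'cV[R]_n.

Lemma bil_ge0 v : 0 <= bil Q v v.
Proof.
by have [->|/posQ/ltW//] := eqVneq v 0; rewrite /bil mulmx0 mxE.
Qed.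

Lemma posdef_diag_ge0 i : 0 <= Q i i.
Proof.
by have := bil_ge0 (delta_mx i 0); rewrite /bil trmx_delta -rowE -colE !mxE.
Qed.

Lemma posdef_unitmx : Q \in unitmx.
Proof.
rewrite -row_free_unit -kermx_eq0; apply/negPn/negP.
case/rowV0Pn => v; rewrite sub_kermx => /eqP vQ v0.
have := @posQ v^T; rewrite /bil trmxK vQ mul0mx mxE ltxx => vT.
suff /vT : v^T != 0 by [].
by apply: contra_neq v0 => vT0; rewrite -[v]trmxK vT0 trmx0.
Qed.

Lemma bil_invmx u v : bil Q (invmx Q *m u) v = (u^T *m v) 0 0.
Proof.
by rewrite /bil trmx_mul trmx_inv symQ mulmxKV ?posdef_unitmx.
Qed.

Lemma invmx_sym : (invmx Q)^T = invmx Q.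
Proof. by rewrite trmx_inv symQ. Qed.

Lemma invmx_posdef v : v != 0 -> 0 < bil (invmx Q) v v.
Proof.
move=> v0; have := @posQ (invmx Q *m v).
rewrite bil_invmx mulmxA -/(bil _ _ _); apply.
apply: contra_neq v0 => /(congr1 (mulmx Q)).
by rewrite mulKVmx ?posdef_unitmx// mulmx0.
Qed.

Lemma bil_Cauchy_Schwarz u v : bil Q u v ^+ 2 <= bil Q u u * bil Q v v.
Proof.
have [->|/posQ v_gt0] := eqVneq v 0.
  by rewrite /bil !mulmx0 mxE mulr0 expr0n.
have := bil_ge0 (bil Q v v *: u - bil Q u v *: v).
rewrite -scaleNr bilDl !bilDr !bilZl !bilZr (bilC v u symQ) => h.
rewrite -subr_ge0 -(pmulr_rge0 _ v_gt0); move: h; congr (_ <= _); ring.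
Qed.

(** The [i]-th coordinate is the [Q]-product with [invmx Q *m delta_mx i 0], a vector whose
    [Q]-square is [invmx Q i i]; Cauchy-Schwarz concludes. *)
Lemma coord_sqr_le v i : v i 0 ^+ 2 <= invmx Q i i * bil Q v v.
Proof.
have := bil_Cauchy_Schwarz (invmx Q *m delta_mx i 0) v.
rewrite !bil_invmx trmx_delta -!rowE -colE !mxE; exact.
Qed.

Lemma bil_young a u v : 0 < a ->
  2 * bil Q u v <= a * bil Q u u + a^-1 * bil Q v v.
Proof.
move=> a_gt0; have := bil_ge0 (a *: u - v).
rewrite -[- v]scaleN1r bilDl !bilDr !bilZl !bilZr (bilC v u symQ) => h.
rewrite -(ler_pM2l a_gt0) mulrDr mulVKf ?gt_eqF//; lra.
Qed.

End PositiveForms.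

Lemma bil_bound (R : realFieldType) n (Q : 'M[R]_n) (u v : 'cV[R]_n) a b :
  (forall i, `|u i 0| <= a) -> (forall i, `|v i 0| <= b) ->
  `|bil Q u v| <= (\sum_i \sum_j `|Q i j|) * (a * b).
Proof.
move=> ua vb; rewrite bilE (le_trans (ler_norm_sum _ _ _))// mulr_suml.
apply: ler_sum => i _; rewrite (le_trans (ler_norm_sum _ _ _))// mulr_suml.
apply: ler_sum => j _; rewrite !normrM mulrAC mulrC ler_wpM2l//.
by rewrite ler_pM.
Qed.

(** * Calculus on the half-line *)

Section Calculus.
Variable R : realType.
Implicit Types (f g G df : R -> R) (a b t x y : R).
Notation mu := (@lebesgue_measure R).

Lemma mean_value f df (a b : R) : a <= b ->
  (forall x, a <= x <= b -> is_derive x 1 f (df x)) ->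
  exists2 c, a <= c <= b & f b - f a = df c * (b - a).
Proof.
move=> ab dfE; have [||c cab E] := @MVT_segment R f df a b ab.
- by move=> x /itvP xab; apply: dfE; rewrite !xab.
- apply: derivable_within_continuous => x /itvP xab.
  by have [] : is_derive x 1 f (df x) by apply: dfE; rewrite !xab.
- by exists c => //; rewrite !(itvP cab).
Qed.

Lemma continuous_integrable f a b : continuous f ->
  mu.-integrable `[a, b] (EFin \o f).
Proof.
move=> cf; apply: continuous_compact_integrable; first exact: segment_compact.
exact: continuous_subspaceT.
Qed.

Lemma RintegralB0 f a b t : a <= b <= t -> mu.-integrable `[a, t] (EFin \o f) ->
  Rintegral mu `[b, t] f = Rintegral mu `[a, t] f - Rintegral mu `[a, b] f.
Proof.
move=> /andP[ab bt] intf.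
rewrite (@Rintegral_itvB R f (BLeft a) (BRight t) b)// ?bnd_simp//.
rewrite Rintegral_itv_obnd_cbnd//; apply: integrableS intf => //.
by apply: subset_itvr; rewrite bnd_simp.
Qed.

Lemma antiderivative f : continuous f ->
  exists2 G, forall t, 0 <= t -> is_derive t 1 G (f t) &
    forall t, 0 <= t -> Rintegral mu `[0, t] f = G t - G 0.
Proof.
(* Integrating from -1 makes 0 an interior point, so that [G] has a two-sided derivative there
   too. *)
move=> cf; pose G t := Rintegral mu `[-1, t] f.
have GE t : 0 <= t -> derivable G t 1 /\ derive1 G t = f t.
  move=> t0; apply: (@continuous_FTC1_closed R f (-1) t (t + 1)).
  - by rewrite ltrDl.
  - exact: continuous_integrable.
  - by rewrite (lt_le_trans _ t0)// ltrN10.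
  - exact: cf.
exists G => t t0.
  have [dG dGE] := GE t t0; clear -dG dGE; move: G dG dGE => G dG dGE.
  by apply: DeriveDef; [exact: dG|rewrite -derive1E; exact: dGE].
by apply: RintegralB0; [rewrite lerN10|exact: continuous_integrable].
Qed.

Definition clamp (a b x : R) := Num.max a (Num.min b x).

Lemma clamp_ge a b x : a <= clamp a b x.
Proof. by rewrite /clamp le_max lexx. Qed.

Lemma clamp_le a b x : a <= b -> clamp a b x <= b.
Proof. by move=> ab; rewrite /clamp ge_max ab ge_min lexx. Qed.

Lemma clamp_id a b x : a <= x <= b -> clamp a b x = x.
Proof.
by move=> /andP[ax xb]; rewrite /clamp (min_idPr xb) (max_idPr ax).
Qed.

Lemma clamp_lipschitz a b x y : `|clamp a b x - clamp a b y| <= `|x - y|.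
Proof.
have h1 u v : u - v <= `|u - v| :> R := ler_norm _.
have h2 u v : v - u <= `|u - v| :> R by rewrite distrC.
have maxL u v : `|Num.max a u - Num.max a v| <= `|u - v|.
  have := (h1 u v, h2 u v) => -[]; rewrite ler_norml => ? ?.
  by case: (leP a u) => ?; case: (leP a v) => ?; apply/andP; split; lra.
have minL u v : `|Num.min b u - Num.min b v| <= `|u - v|.
  have := (h1 u v, h2 u v) => -[]; rewrite ler_norml => ? ?.
  by case: (leP b u) => ?; case: (leP b v) => ?; apply/andP; split; lra.
exact: le_trans (maxL _ _) (minL _ _).
Qed.

Lemma lipschitz_continuous K f : (forall x y, `|f x - f y| <= K * `|x - y|) ->
  continuous f.
Proof.
move=> lf x; apply/cvgrPdist_le => e e0.
have K1 : 0 < `|K| + 1 by rewrite ltr_wpDl.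
near=> y; rewrite (le_trans (lf _ _))//.
rewrite (@le_trans _ _ ((`|K| + 1) * `|x - y|))//.
  by rewrite ler_wpM2r// (le_trans (ler_norm K))// lerDl.
rewrite -ler_pdivlMl//.
near: y; apply: cvgr_dist_le; [exact: cvg_id|].
by rewrite mulr_gt0// invr_gt0.
Unshelve. all: by end_near. Qed.

Lemma clamp_continuous a b : continuous (clamp a b).
Proof.
apply: (@lipschitz_continuous 1) => x y; rewrite mul1r; exact: clamp_lipschitz.
Qed.

Lemma within_continuous_clamp f a b : a <= b ->
  {within `[a, b], continuous f} -> continuous (f \o clamp a b).
Proof.
move=> ab /subspace_continuousP cf x.
have cx : [set` `[a, b]] (clamp a b x) by rewrite /= in_itv/= clamp_ge clamp_le.
move=> A fA; have near_x := @clamp_continuous a b x _ (cf _ cx _ fA).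
change (nbhs x [set y | A (f (clamp a b y))]).
apply: (@filterS _ (nbhs x) (nbhs_filter x) _ _ _ near_x) => y /=; apply.
by rewrite /= in_itv/= clamp_ge clamp_le.
Qed.

Lemma integral_clamp_continuous f b : 0 <= b ->
  mu.-integrable `[0, b] (EFin \o f) ->
  continuous (fun t => Rintegral mu `[0, clamp 0 b t] f).
Proof.
move=> b0 intf; have := @within_continuous_clamp (fun t => Rintegral mu `[0, t] f) 0 b b0.
by apply; exact: parameterized_integral_continuous.
Qed.

Lemma is_derive_bil n (Q : 'M[R]_n) (z dz : R -> 'cV[R]_n) t : Q^T = Q ->
  (forall i, is_derive t 1 (fun s => z s i 0) (dz t i 0)) ->
  is_derive t 1 (fun s => bil Q (z s) (z s)) (2 * bil Q (z t) (dz t)).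
Proof.
move=> symQ dzE.
have -> : (fun s => bil Q (z s) (z s)) =
    \sum_i \sum_j (fun s => z s i 0 * Q i j * z s j 0).
  apply/funext => s; rewrite bilE fct_sumE; apply: eq_bigr => i _.
  by rewrite fct_sumE.
have -> : 2 * bil Q (z t) (dz t) = \sum_i \sum_j
    (dz t i 0 * Q i j * z t j 0 + z t i 0 * Q i j * dz t j 0).
  rewrite mulrDl mul1r {1}(bilC _ _ symQ) !bilE -big_split; apply: eq_bigr => i _.
  by rewrite -big_split.
apply: is_derive_sum => i; apply: is_derive_sum => j.
apply: is_derive_eq.
rewrite /= /GRing.scale /=; ring.
Qed.

(* [(V - k / a) exp (a t)] is nonincreasing. *)
Lemma decay_bound (V dV : R -> R) (a k b : R) : 0 < a -> 0 <= k ->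
  (forall t, 0 <= t <= b -> is_derive t 1 V (dV t)) ->
  (forall t, 0 <= t <= b -> 0 <= V t /\ dV t <= - a * V t + k) ->
  forall t, 0 <= t <= b -> V t <= V 0 + k / a.
Proof.
move=> a0 k0 dVE dVle t /andP[t0 tb].
pose W s := (V s - k / a) * expR (a * s).
have [s /andP[s0 st] WE] : exists2 s, 0 <= s <= t &
    W t - W 0 = ((dV s + a * (V s - k / a)) * expR (a * s)) * (t - 0).
  apply: (@mean_value W (fun s => (dV s + a * (V s - k / a)) * expR (a * s)))
    => // s /andP[s0 st].
  have := dVE s; rewrite s0 (le_trans st tb) => /(_ erefl) dVs.
  rewrite /W; apply: is_derive_eq.
  rewrite /= /GRing.scale /=; ring.
have [_ dVs] : 0 <= V s /\ dV s <= - a * V s + k.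
  by apply: dVle; rewrite s0 (le_trans st).
have [|V0 _] := dVle 0; first by rewrite lexx (le_trans t0).
have : W t <= W 0.
  rewrite -subr_le0 WE subr0 mulr_le0_ge0// mulr_le0_ge0 ?expR_ge0//.
  by rewrite mulrBr mulrCA divff ?gt_eqF// mulr1; lra.
rewrite /W mulr0 expR0 mulr1 => Wle.
have E1 : 1 <= expR (a * t) by rewrite -expR0 ler_expR mulr_ge0// ltW.
have ka : 0 <= k / a by rewrite divr_ge0// ltW.
have [Vt_le|/ltW Vt_ge] := leP (V t - k / a) 0; first lra.
have := ler_peMr Vt_ge E1; lra.
Qed.

End Calculus.

(** * Carathéodory solutions *)

Section EntrywiseContinuity.
Variable R : realType.

(** Continuity is taken entry by entry, to match the coordinatewise integrals of [ode_on]. *)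
Definition entry_continuous m n (X : R -> 'M[R]_(m, n)) :=
  forall i j, continuous (fun t => X t i j).

Lemma entry_continuous_cst m n (A : 'M[R]_(m, n)) : entry_continuous (fun=> A).
Proof. by move=> i j t; exact: cvg_cst. Qed.

Lemma entry_continuousD m n (X Y : R -> 'M[R]_(m, n)) :
  entry_continuous X -> entry_continuous Y ->
  entry_continuous (fun t => X t + Y t).
Proof.
move=> cX cY i j t.
rewrite (_ : (fun t => _) = (fun t => X t i j) \+ (fun t => Y t i j)).
  by apply: cvgD; [exact: cX|exact: cY].
by apply/funext => s; rewrite mxE.
Qed.

Lemma entry_continuousN m n (X : R -> 'M[R]_(m, n)) :
  entry_continuous X -> entry_continuous (fun t => - X t).
Proof.
move=> cX i j t; rewrite (_ : (fun t => _) = \- (fun t => X t i j)).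
  by apply: cvgN; exact: cX.
by apply/funext => s; rewrite mxE.
Qed.

Lemma continuous_big_sum (I : finType) (f : I -> R -> R) :
  (forall i, continuous (f i)) -> continuous (fun t => \sum_i f i t).
Proof.
move=> cf; elim: (index_enum I) => [|i s IH] t.
  by under eq_fun do rewrite big_nil; exact: cvg_cst.
under eq_fun do rewrite big_cons.
by apply: cvgD; [exact: cf|exact: IH].
Qed.

Lemma entry_continuousM m n p (X : R -> 'M[R]_(m, n)) (Y : R -> 'M[R]_(n, p)) :
  entry_continuous X -> entry_continuous Y ->
  entry_continuous (fun t => X t *m Y t).
Proof.
move=> cX cY i j.
rewrite (_ : (fun t => _) = (fun t => \sum_k X t i k * Y t k j)).
  apply: continuous_big_sum => k t; apply: cvgM; [exact: cX|exact: cY].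
by apply/funext => s; rewrite mxE.
Qed.

Lemma entry_continuous_tr m n (X : R -> 'M[R]_(m, n)) :
  entry_continuous X -> entry_continuous (fun t => (X t)^T).
Proof.
move=> cX i j; rewrite (_ : (fun t => _) = (fun t => X t j i)); first exact: cX.
by apply/funext => s; rewrite mxE.
Qed.

Lemma entry_continuousZ m n (a : R -> R) (X : R -> 'M[R]_(m, n)) :
  continuous a -> entry_continuous X -> entry_continuous (fun t => a t *: X t).
Proof.
move=> ca cX i j t.
rewrite (_ : (fun t => _) = (fun t => a t * X t i j)).
  by apply: cvgM; [exact: ca|exact: cX].
by apply/funext => s; rewrite mxE.
Qed.

End EntrywiseContinuity.

Lemma mulmx_entry_bound (R : realFieldType) m n (A : 'M[R]_(m, n))
    (u : 'cV[R]_n) (K : R) : 0 <= K -> (forall j, `|u j 0| <= K) ->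
  forall i, `|(A *m u) i 0| <= (\sum_i \sum_j `|A i j|) * K.
Proof.
move=> K0 uK i; rewrite mxE (le_trans (ler_norm_sum _ _ _))//.
apply: (@le_trans _ _ ((\sum_j `|A i j|) * K)).
  by rewrite mulr_suml ler_sum// => j _; rewrite normrM ler_wpM2l.
rewrite ler_wpM2r// (bigD1 i)//= lerDl sumr_ge0// => j _.
by rewrite sumr_ge0.
Qed.

Section Caratheodory.
Variable R : realType.
Notation mu := (@lebesgue_measure R).

Lemma is_derive_shift (f : R -> R) (t c df : R) :
  is_derive (t + c) 1 f df -> is_derive t 1 (fun s => f (s + c)) df.
Proof.
move=> [df_ex dfE].
have E : (fun h : R => h^-1 *: (((fun s => f (s + c)) \o shift t) (h *: 1) - f (t + c)))
       = (fun h : R => h^-1 *: ((f \o shift (t + c)) (h *: 1) - f (t + c))).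
  by apply/funext => h; rewrite /= addrA.
by apply: DeriveDef; [rewrite /derivable E|rewrite /derive E].
Qed.

Lemma Rintegral_bound (f : R -> R) (a b K : R) : a <= b ->
  mu.-integrable `[a, b] (EFin \o f) -> (forall s : R, a <= s <= b -> `|f s| <= K) ->
  `|Rintegral mu `[a, b] f| <= K * (b - a).
Proof.
move=> ab intf fK; rewrite (le_trans (le_normr_Rintegral _ intf))//.
have -> : K * (b - a) = Rintegral mu `[a, b] (cst K).
  rewrite Rintegral_cst//= lebesgue_measure_itv/= lte_fin.
  case: ltP => //= ba.
  by congr (_ * _); lra.
apply: le_Rintegral => //; first exact: integrable_norm.
  by apply: continuous_integrable => x; exact: cvg_cst.
Qed.

Lemma integrable_sub (f g : R -> R) (a b : R) :
  mu.-integrable `[a, b] (EFin \o f) -> mu.-integrable `[a, b] (EFin \o g) ->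
  mu.-integrable `[a, b] (EFin \o (fun s => f s - g s)).
Proof. by move=> intf intg; apply: (integrableB _ intf intg). Qed.

Lemma ode_onB n (T : \bar R) (X Y F G : R -> 'cV[R]_n) :
  ode_on T X F -> ode_on T Y G ->
  ode_on T (fun t => X t - Y t) (fun t => F t - G t).
Proof.
move=> odeX odeY t t0 tT i.
have [iF XE] := odeX t t0 tT i; have [iG YE] := odeY t t0 tT i.
rewrite (_ : (fun s => (F s - G s) i 0) = (fun s => F s i 0 - G s i 0)); last first.
  by apply/funext => s; rewrite !mxE.
split; first exact: integrable_sub.
by rewrite RintegralB// !mxE XE YE; lra.
Qed.

(** Solutions are arbitrary outside [[0, T[]. Freezing time outside [[0, t1]] yields signals
    continuous on the whole line, the form in which the calculus lemmas accept them. *)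
Lemma ode_on_clamp_continuous n (T : \bar R) (X F : R -> 'cV[R]_n) (t1 : R) :
  ode_on T X F -> 0 <= t1 -> (t1%:E < T)%E ->
  entry_continuous (fun t => X (clamp 0 t1 t)).
Proof.
move=> odeX t0 tT i j; rewrite ord1.
rewrite (_ : (fun t => _) =
    (fun t => X 0 i 0 + Rintegral mu `[0, clamp 0 t1 t] (fun s => F s i 0))).
  move=> t; apply: cvgD; first exact: cvg_cst.
  apply: integral_clamp_continuous => //; exact: (odeX t1 t0 tT i).1.
apply/funext => t; have [] // := odeX (clamp 0 t1 t) (clamp_ge _ _ _) _ i.
by rewrite (le_lt_trans _ tT)// lee_fin clamp_le.
Qed.

(** A replacement [Y] is needed because [X] is unconstrained at negative times, so it may have no
    derivative at 0, and because [F] is compared with [f] on [[0, t1]] only. *)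
Lemma ode_on_C1 n (T : \bar R) (X F f : R -> 'cV[R]_n) (t1 : R) :
  ode_on T X F -> 0 <= t1 -> (t1%:E < T)%E ->
  entry_continuous f -> (forall t : R, 0 <= t <= t1 -> F t = f t) ->
  exists2 Y : R -> 'cV[R]_n, forall t : R, 0 <= t <= t1 -> Y t = X t &
    forall (t : R) i, 0 <= t -> is_derive t 1 (fun s => Y s i 0) (f t i 0).
Proof.
move=> odeX t0 tT cf Ff.
have /choice[G GE] : forall i, exists G : R -> R,
    (forall t : R, 0 <= t -> is_derive t 1 G (f t i 0)) /\
    (forall t : R, 0 <= t -> Rintegral mu `[0, t] (fun s => f s i 0) = G t - G 0).
  by move=> i; have [G G1 G2] := antiderivative (cf i 0); exists G.
exists (fun t => \col_i (X 0 i 0 + (G i t - G i 0))) => t.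
  move=> /andP[t_ge0 tt1]; apply/matrixP => i j; rewrite ord1 mxE.
  rewrite -(GE i).2// (odeX t t_ge0 _ i).2; last first.
    by rewrite (le_lt_trans _ tT)// lee_fin.
  congr (_ + _); apply: eq_Rintegral => s /[!inE]/=; rewrite in_itv/= => /andP[s0 st].
  by rewrite Ff// s0 (le_trans st).
move=> i t_ge0; have dG := (GE i).1 t t_ge0.
rewrite (_ : (fun s => _) = (fun s => X 0 i 0 + (G i s - G i 0))).
  by apply: is_derive_eq; ring.
by apply/funext => s; rewrite mxE.
Qed.

(** With [V = bil Q Z Z], the derivative is at most [- 2 * c * V + 2 * bil Q Z f]. Young's
    inequality with weight [c] absorbs half of the decay and leaves [- c * V + c^-1 * S], to which
    [decay_bound] applies. *)
Lemma bibo_smooth n (A : 'M[R]_n) (K : R) : hurwitz A -> 0 <= K ->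
  exists C : R, forall (Z f : R -> 'cV[R]_n) (t1 : R),
    (forall (t : R) i, 0 <= t <= t1 ->
       is_derive t 1 (fun s => Z s i 0) ((A *m Z t + f t) i 0)) ->
    (forall (t : R) i, 0 <= t <= t1 -> `|f t i 0| <= K) ->
    (forall i, `|Z 0 i 0| <= K) ->
    forall (t : R) i, 0 <= t <= t1 -> `|Z t i 0| <= C.
Proof.
move=> hA K0; have [Q [c [symQ posQ c0 decQ]]] := lyapunov_form hA.
pose S := (\sum_i \sum_j `|Q i j|) * (K * K).
have S0 : 0 <= S.
  rewrite /S !mulr_ge0// sumr_ge0// => i _; exact: sumr_ge0.
pose W := S + c^-1 * S / c.
have ci : 0 <= c^-1 by rewrite invr_ge0 ltW.
have W0 : 0 <= W by apply: addr_ge0 => //; rewrite mulr_ge0// mulr_ge0.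
have qi0 i : 0 <= invmx Q i i.
  exact: posdef_diag_ge0 (invmx_posdef symQ posQ) i.
pose q := \sum_i invmx Q i i.
(* A number whose square is at most [q * W] is at most [1 + q * W]. *)
exists (1 + q * W) => Z f t1 dZ fK Z0K t i tt1.
pose V (s : R) := bil Q (Z s) (Z s).
have VW : V t <= V 0 + c^-1 * S / c.
  apply: (@decay_bound R V (fun s => 2 * bil Q (Z s) (A *m Z s + f s)) c _ t1)
    => //; first exact: mulr_ge0.
    move=> s st1; apply: (@is_derive_bil R n Q Z (fun s => A *m Z s + f s)) => // j.
    exact: dZ.
  move=> s st1; split; first exact: bil_ge0.
  rewrite bilDr; have := decQ (Z s).
  have := bil_young symQ posQ (Z s) (f s) c0.
  have : bil Q (f s) (f s) <= S.
    by rewrite (le_trans (ler_norm _))// bil_bound// => j; exact: fK.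
  rewrite -/(V s).
  move=> /(ler_wpM2l ci); lra.
have V0S : V 0 <= S by rewrite (le_trans (ler_norm _))// bil_bound.
have VtW : V t <= W by rewrite (le_trans VW)// lerD2r.
have iq : invmx Q i i <= q.
  by rewrite /q (bigD1 i)//= lerDl sumr_ge0.
have sq : `|Z t i 0| ^+ 2 <= q * W.
  rewrite -normrX ger0_norm ?sqr_ge0// (le_trans (coord_sqr_le symQ posQ _ _))//.
  by rewrite ler_pM// bil_ge0.
nra.
Qed.

(* Subtracting from the integral [rho] of the input its moving average over unit
   windows leaves a bounded function, whose removal makes the state C^1. *)
Lemma bibo n (A : 'M[R]_n) (K : R) : hurwitz A -> 0 <= K ->
  exists C : R, forall (T : \bar R) (X w : R -> 'cV[R]_n),
    ode_on T X (fun t => A *m X t + w t) ->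
    (forall (t : R) i, 0 <= t -> (t%:E < T)%E -> `|w t i 0| <= K) ->
    (forall i, `|X 0 i 0| <= K) ->
    forall (t : R) i, 0 <= t -> (t%:E < T)%E -> `|X t i 0| <= C.
Proof.
move=> hA K0; pose nA := \sum_i \sum_j `|A i j|.
have nA0 : 0 <= nA by apply: sumr_ge0 => i _; exact: sumr_ge0.
(* The smoothed state [Z] below has forcing at most [nA * K + K] and initial value at most [K + K];
   this level covers both. *)
have [|C CP] := @bibo_smooth n A (nA * K + K + K) hA.
  by rewrite !addr_ge0// mulr_ge0.
exists (C + K) => T X w odeX wK X0K t1 i0 t1_ge0 t1T.
have cX := ode_on_clamp_continuous odeX t1_ge0 t1T.
have cAX : entry_continuous (fun t => A *m X (clamp 0 t1 t)).
  by apply: entry_continuousM => //; exact: entry_continuous_cst.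
(* Only the whole right-hand side is known to be integrable; subtracting its continuous part
   [A *m X] recovers the input. *)
have intw (t : R) i : 0 <= t -> (t%:E < T)%E ->
    mu.-integrable `[0, t] (EFin \o (fun s => w s i 0)).
  move=> t0 tT; have [intF _] := odeX t t0 tT i.
  have cAXt : entry_continuous (fun s => A *m X (clamp 0 t s)).
    apply: entry_continuousM; first exact: entry_continuous_cst.
    exact: ode_on_clamp_continuous odeX t0 tT.
  have := integrable_sub intF (continuous_integrable 0 t (cAXt i 0)).
  apply: eq_integrable => // s /[!inE] /itvP st.
  by rewrite /= [(A *m _ + _) i 0]mxE clamp_id ?st//; congr EFin; ring.
pose rho (t : R) : 'cV[R]_n := \col_i Rintegral mu `[0, t] (fun s => w s i 0).
have rho0 i : rho 0 i 0 = 0.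
  by rewrite mxE set_itv1 Rintegral_set1.
(* Without [rho] the right-hand side is [A *m X], which is continuous. As [rho] itself may grow
   linearly, this regularity gives no uniform bound yet. *)
have odeY : ode_on T (fun t => X t - rho t) (fun t => A *m X t + w t - w t).
  apply: ode_onB odeX _ => t t0 tT i.
  by split; [exact: intw|rewrite rho0 add0r mxE].
have [|Y YE dY] := ode_on_C1 odeY t1_ge0 t1T cAX.
  by move=> t tt1; rewrite addrK clamp_id.
(* Freezing [rho] after [t1] allows windows [[t, t + 1]] that extend past [t1], and past [T]. *)
pose rhoc i (t : R) := rho (clamp 0 t1 t) i 0.
have lip (s t : R) i : `|rhoc i s - rhoc i t| <= K * `|s - t|.
  rewrite /rhoc; wlog st : s t / clamp 0 t1 s <= clamp 0 t1 t.
    move=> H; have [/H//|/ltW/H] := leP (clamp 0 t1 s) (clamp 0 t1 t).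
    by rewrite distrC (distrC t).
  have CtT : ((clamp 0 t1 t)%:E < T)%E.
    by rewrite (le_lt_trans _ t1T)// lee_fin clamp_le.
  have intt := intw _ i (clamp_ge _ _ _) CtT.
  rewrite distrC !mxE -RintegralB0 ?clamp_ge//.
  have int_st : mu.-integrable `[clamp 0 t1 s, clamp 0 t1 t] (EFin \o (fun s => w s i 0)).
    apply: integrableS intt => //; apply: subset_itvr.
    by rewrite bnd_simp clamp_ge.
  rewrite (le_trans (Rintegral_bound st int_st (K := K) _))//.
    move=> u /andP[su ut]; apply: wK; first by rewrite (le_trans _ su)// clamp_ge.
    by rewrite (le_lt_trans _ CtT)// lee_fin.
  rewrite ler_wpM2l// (le_trans (ler_norm _))// distrC; exact: clamp_lipschitz.
have crho i : continuous (rhoc i).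
  by apply: (@lipschitz_continuous R K) => s t; exact: lip.
have /choice[N NE] : forall i, exists N : R -> R,
    forall t : R, 0 <= t -> is_derive t 1 N (rhoc i t).
  by move=> i; have [N N1 _] := antiderivative (crho i); exists N.
(* [v t] is the mean of [rhoc] over [[t, t + 1]]. Since [rhoc] is [K]-Lipschitz, [v] stays within
   [K] of it, and the derivative of [v] is at most [K] in size, uniformly in time. *)
pose v (t : R) : 'cV[R]_n := \col_i (N i (t + 1) - N i t).
have dv (t : R) i : 0 <= t -> is_derive t 1 (fun s => v s i 0) (rhoc i (t + 1) - rhoc i t).
  move=> t0; rewrite (_ : (fun s => _) = (fun s => N i (s + 1)) - N i); last first.
    by apply/funext => s; rewrite mxE.
  have dN := NE i t t0.
  have dN1 : is_derive (t + 1) 1 (N i) (rhoc i (t + 1)).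
    by apply: NE; rewrite addr_ge0.
  have dN1' := is_derive_shift dN1.
  exact: is_deriveB.
have vrho (t : R) i : 0 <= t -> `|v t i 0 - rhoc i t| <= K.
  move=> t0; have [||c /andP[tc ct] cE] := @mean_value R (N i) (rhoc i) t (t + 1).
  - by rewrite lerDl.
  - by move=> s /andP[ts _]; apply: NE; rewrite (le_trans t0).
  rewrite mxE cE (_ : t + 1 - t = 1) ?mulr1; last by ring.
  rewrite (le_trans (lip _ _ _))//.
  rewrite ler_piMr// ger0_norm ?subr_ge0// lerBlDr addrC; lra.
(* On [[0, t1]], [Z] is [X - rho + v], a bounded perturbation of [X]; rewriting [A *m X] in terms of
   [Z] produces the bounded forcing [f]. *)
pose Z (t : R) := Y t + v t.
pose f (t : R) : 'cV[R]_n := A *m (\col_i (rhoc i t - v t i 0)) +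
                       \col_i (rhoc i (t + 1) - rhoc i t).
have XE (t : R) i : 0 <= t <= t1 -> X t i 0 = Z t i 0 + (rhoc i t - v t i 0).
  move=> tt1; rewrite /Z mxE YE// /rhoc clamp_id// !mxE; lra.
have ZC : `|Z t1 i0 0| <= C.
  apply: (CP Z f t1).
  - move=> t i /andP[t0 tt1]; have tt : 0 <= t <= t1 by rewrite t0.
    have -> : (A *m Z t + f t) i 0 =
        (A *m X (clamp 0 t1 t)) i 0 + (rhoc i (t + 1) - rhoc i t).
      rewrite /f addrA -mulmxDr mxE [X in _ + X]mxE; congr ((A *m _) i 0 + _).
      apply/matrixP => j k; rewrite ord1 clamp_id// (XE t j)//.
      by rewrite [LHS]mxE [X in _ + X]mxE.
    rewrite (_ : (fun s => _) = (fun s => Y s i 0 + v s i 0)); last first.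
      by apply/funext => s; rewrite mxE.
    have dYt := dY t i t0; have dvt := dv t i t0.
    exact: is_deriveD.
  - move=> t i /andP[t0 tt1]; rewrite mxE (le_trans (ler_normD _ _))//.
    rewrite -addrA lerD//.
      apply: mulmx_entry_bound => // j; rewrite mxE distrC; exact: vrho.
    rewrite mxE (le_trans (lip _ _ _))// addrAC subrr add0r normr1 mulr1.
    by rewrite lerDl.
  - move=> i; have -> : Z 0 i 0 = X 0 i 0 + (v 0 i 0 - rhoc i 0).
      by rewrite XE ?lexx//; ring.
    rewrite (le_trans (ler_normD _ _))// lerD//; last exact: vrho.
    by rewrite (le_trans (X0K i))// lerDr mulr_ge0.
  - by rewrite t1_ge0 lexx.
rewrite XE ?t1_ge0 ?lexx// (le_trans (ler_normD _ _))// lerD//.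
by rewrite distrC vrho.
Qed.

End Caratheodory.

(** * Energy of the error dynamics *)

Section Energy.
Variables (R : realType) (n : nat) (Ap : 'M[R]_n) (b : 'cV[R]_n).
Variables (Am L Gamma P : 'M[R]_n) (r : R -> R) (theta_star : 'cV[R]_n).
Hypotheses (hGamma : sym_posdef Gamma) (hP : sym_posdef P).
Hypothesis hLyap : (Am + L)^T *m P + P *m (Am + L) = - 1%:M.
Hypothesis hmatch : Am = Ap + b *m theta_star^T.

Definition energy (e th : 'cV[R]_n) :=
  bil P e e + bil (invmx Gamma) (th - theta_star) (th - theta_star).

Lemma error_rate (x xm th : 'cV[R]_n) (rt : R) :
  Ap *m x + ((th^T *m x) 0 0 + rt) *: b -
    (Am *m xm + rt *: b - L *m (x - xm)) =
  (Am + L) *m (x - xm) + ((th - theta_star)^T *m x) 0 0 *: b.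
Proof.
have -> : Ap = Am - b *m theta_star^T by rewrite hmatch addrK.
have bx : b *m theta_star^T *m x = (theta_star^T *m x) 0 0 *: b.
  by rewrite -mulmxA [theta_star^T *m x]mx11_scalar mul_mx_scalar !mxE.
have -> : ((th - theta_star)^T *m x) 0 0 =
    (th^T *m x) 0 0 - (theta_star^T *m x) 0 0.
  by rewrite linearB/= mulmxBl !mxE.
rewrite mulmxBl bx mulmxDl mulmxBr mulmxBr.
move: (Am *m x) (Am *m xm) (L *m x) (L *m xm) ((th^T *m x) 0 0)
  ((theta_star^T *m x) 0 0) => u1 u2 u3 u4 c1 c2.
by apply/matrixP => i j; rewrite !mxE; ring.
Qed.

(* The update law is chosen so that the two cross terms cancel. *)
Lemma energy_rate (e x th : 'cV[R]_n) :
  2 * bil P e ((Am + L) *m e + ((th - theta_star)^T *m x) 0 0 *: b) +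
  2 * bil (invmx Gamma) (th - theta_star) (- (Gamma *m x *m e^T *m P *m b)) =
  - bil 1%:M e e.
Proof.
have Gu := posdef_unitmx hGamma.2.
have -> : Gamma *m x *m e^T *m P *m b = bil P e b *: (Gamma *m x).
  rewrite -(mulmxA _ P b) -(mulmxA (Gamma *m x)) (mulmxA e^T).
  by rewrite [e^T *m P *m b]mx11_scalar mul_mx_scalar.
have Gx u : bil (invmx Gamma) u (Gamma *m x) = (u^T *m x) 0 0.
  by rewrite /bil mulmxA mulmxKV.
rewrite bilDr bilZr bilNr bilZr Gx.
have -> : - bil 1%:M e e = 2 * bil P e ((Am + L) *m e).
  have -> : - bil 1%:M e e = bil (- 1%:M) e e.
    by rewrite /bil mulmxN mulNmx [RHS]mxE.
  rewrite -hLyap mulrDl mul1r {1}(bilC _ _ hP.1).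
  by rewrite /bil trmx_mul mulmxDr mulmxDl mxE !mulmxA.
ring.
Qed.

(** An intermediate point replaces the integral of the dissipation: its sign gives monotonicity, and
    the point itself is where the convergence proof finds a small error. *)
Lemma energy_mean_value (T : \bar R) (x xm theta : R -> 'cV[R]_n) (s t : R) :
  closed_loop Ap b Am L Gamma P r T x xm theta ->
  0 <= s <= t -> (t%:E < T)%E ->
  exists2 c, s <= c <= t &
    energy (x t - xm t) (theta t) - energy (x s - xm s) (theta s) =
    - bil 1%:M (x c - xm c) (x c - xm c) * (t - s).
Proof.
move=> [ode_x ode_xm ode_th] /andP[s0 st] tT; have t0 := le_trans s0 st.
have cx := ode_on_clamp_continuous ode_x t0 tT.
have cxm := ode_on_clamp_continuous ode_xm t0 tT.
have cth := ode_on_clamp_continuous ode_th t0 tT.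
have ce : entry_continuous (fun s => x (clamp 0 t s) - xm (clamp 0 t s)).
  by apply: entry_continuousD => //; exact: entry_continuousN.
have cst0 := @entry_continuous_cst R.
(* Neither rate contains [r], so both are continuous once time is clamped; this is what gives [e]
   and [theta] differentiable representatives. *)
pose fe (u : R) := (Am + L) *m (x u - xm u) + ((theta u - theta_star)^T *m x u) 0 0 *: b.
pose fth (u : R) := - (Gamma *m x u *m (x u - xm u)^T *m P *m b).
have [||Ye YeE dYe] := ode_on_C1 (f := fe \o clamp 0 t) (ode_onB ode_x ode_xm) t0 tT.
- apply: entry_continuousD; first exact: entry_continuousM.
  apply: entry_continuousZ => //; apply: entry_continuousM => //.
  apply: entry_continuous_tr; apply: entry_continuousD => //.
- by move=> u u0t; rewrite /control error_rate /= clamp_id.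
have [||Yth YthE dYth] := ode_on_C1 (f := fth \o clamp 0 t) ode_th t0 tT.
- apply: entry_continuousN; do 3![apply: entry_continuousM => //].
    exact: entry_continuousM.
  exact: entry_continuous_tr.
- by move=> u u0t; rewrite /= clamp_id.
pose th_ (u : R) := Yth u - theta_star.
have dth_ (u : R) i : 0 <= u -> is_derive u 1 (fun v => th_ v i 0) (fth (clamp 0 t u) i 0).
  move=> u0; rewrite (_ : (fun v => _) = (fun v => Yth v i 0 - theta_star i 0)).
    have dY := dYth u i u0; apply: is_derive_eq; ring.
  by apply/funext => v; rewrite !mxE.
have GV := invmx_sym hGamma.1.
have [u sut|c /andP[sc ct] cE] := @mean_value R
    (fun u => bil P (Ye u) (Ye u) + bil (invmx Gamma) (th_ u) (th_ u))
    (fun u => 2 * bil P (Ye u) (fe (clamp 0 t u)) +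
              2 * bil (invmx Gamma) (th_ u) (fth (clamp 0 t u))) s t st.
  have u0 : 0 <= u by case/andP: sut => + _; exact: le_trans.
  apply: is_deriveD.
    by apply: (is_derive_bil (dz := fe \o clamp 0 t) hP.1) => i; exact: dYe.
  by apply: (is_derive_bil (dz := fth \o clamp 0 t) GV) => i; exact: dth_.
exists c; first by rewrite sc ct.
have inI (u : R) : s <= u -> u <= t -> 0 <= u <= t by move=> /(le_trans s0) ->.
move: cE; rewrite /th_ !YeE ?YthE ?inI// => cE.
by rewrite /energy cE clamp_id ?inI// energy_rate.
Qed.

Lemma energy_ge0 (e th : 'cV[R]_n) : 0 <= energy e th.
Proof.
rewrite addr_ge0 ?(bil_ge0 hP.2)//.
by apply: bil_ge0; exact: invmx_posdef hGamma.1 hGamma.2.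
Qed.

Lemma energy_nonincreasing (T : \bar R) (x xm theta : R -> 'cV[R]_n) (s t : R) :
  closed_loop Ap b Am L Gamma P r T x xm theta ->
  0 <= s <= t -> (t%:E < T)%E ->
  energy (x t - xm t) (theta t) <= energy (x s - xm s) (theta s).
Proof.
move=> CL st tT; have [c sct E] := energy_mean_value CL st tT.
rewrite -subr_le0 E mulr_le0_ge0 ?subr_ge0 ?(proj2 (andP st))// oppr_le0 bil1E.
by apply: sumr_ge0 => i _; exact: sqr_ge0.
Qed.

Lemma error_sqr_le (e th : 'cV[R]_n) i :
  e i 0 ^+ 2 <= invmx P i i * energy e th.
Proof.
have Pi0 : 0 <= invmx P i i.
  exact: posdef_diag_ge0 (invmx_posdef hP.1 hP.2) i.
rewrite (le_trans (coord_sqr_le hP.1 hP.2 e i))// ler_wpM2l// lerDl.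
by apply: bil_ge0; exact: invmx_posdef hGamma.1 hGamma.2.
Qed.

Lemma gain_sqr_le (e th : 'cV[R]_n) i :
  (th - theta_star) i 0 ^+ 2 <= Gamma i i * energy e th.
Proof.
have Gi0 : 0 <= Gamma i i by exact: posdef_diag_ge0 hGamma.2 i.
have := coord_sqr_le (invmx_sym hGamma.1) (invmx_posdef hGamma.1 hGamma.2)
  (th - theta_star) i.
rewrite invmxK => /le_trans; apply.
by rewrite ler_wpM2l// lerDr (bil_ge0 hP.2).
Qed.

End Energy.

(** * Volterra equations *)

Lemma le_of_geometric (R : realType) (a b M : R) :
  (forall k, a <= b + M * 2^-1 ^+ k) -> a <= b.
Proof.
move=> ab; apply/ler_addgt0Pr => e e0.
have h2 : `|2^-1 : R| < 1 by rewrite ger0_norm ?invr_ge0// invf_lt1// ltr1n.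
have M1 : 0 < `|M| + 1 by rewrite ltr_wpDl.
have /cvgrPdist_lt/(_ (e / (`|M| + 1)))[|N _ /(_ N (leqnn N))] := cvg_expr h2.
  by rewrite divr_gt0.
rewrite sub0r normrN ltr_pdivlMr// => hN.
rewrite (le_trans (ab N))// lerD2l (le_trans (ler_norm _))// normrM.
rewrite (le_trans _ (ltW hN))// mulrC ler_wpM2l// lerDl//.
Qed.

(** The intervals of centre [a k] and radius [2 * c * 2^-1 ^+ k] are nested, the radius being the
    sum of the remaining steps; [l] is the supremum of their left ends. *)
Lemma geometric_limit (R : realType) (a : nat -> R) (c : R) :
  (forall k, `|a k.+1 - a k| <= c * 2^-1 ^+ k) ->
  exists l, forall k, `|l - a k| <= 2 * c * 2^-1 ^+ k.
Proof.
move=> ac; have c0 : 0 <= c.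
  by have := le_trans (normr_ge0 _) (ac 0%N); rewrite expr0 mulr1.
pose lo k := a k - 2 * c * 2^-1 ^+ k; pose up k := a k + 2 * c * 2^-1 ^+ k.
have step k : lo k <= lo k.+1 /\ up k.+1 <= up k.
  have := ac k; rewrite ler_norml /lo /up exprS => /andP[h1 h2].
  by split; lra.
have lo_up k m : lo k <= up m.
  have lo_mono : {homo lo : i j / (i <= j)%N >-> i <= j}.
    by apply: homo_leq => // [y x z|i]; [exact: le_trans|exact: (step i).1].
  have up_mono : {homo up : i j / (i <= j)%N >-> j <= i}.
    apply: homo_leq => // [y x z xy yz|i]; last exact: (step i).2.
    exact: le_trans yz xy.
  apply: (le_trans (lo_mono _ _ (leq_maxl k m))).
  apply: (le_trans _ (up_mono _ _ (leq_maxr k m))).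
  have d0 : 0 <= 2 * c * 2^-1 ^+ maxn k m by rewrite !mulr_ge0// exprn_ge0// invr_ge0.
  by rewrite /lo /up; lra.
exists (sup (range lo)) => k.
have ub : has_ubound (range lo) by exists (up 0%N) => _ [j _ <-]; exact: lo_up.
have h1 : lo k <= sup (range lo) by apply: ub_le_sup => //; exists k.
have h2 : sup (range lo) <= up k.
  by apply: ge_sup; [exists (lo 0%N); exists 0%N|move=> _ [j _ <-]; exact: lo_up].
by move: h1 h2; rewrite /lo /up ler_norml => h1 h2; apply/andP; split; lra.
Qed.

Section Volterra.
Variable R : realType.
Notation mu := (@lebesgue_measure R).

(** Integration against the exponential weight gains a factor [1 / lam], which will make the Picard
    map contract. The mean value theorem is applied to [k * expR (lam * s) - sg * G s] for both
    signs [sg]. *)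
Lemma exp_integral_bound (f : R -> R) (lam k t : R) : continuous f -> 0 <= k ->
  0 <= t -> (forall s, 0 <= s <= t -> `|f s| <= k * lam * expR (lam * s)) ->
  `|Rintegral mu `[0, t] f| <= k * expR (lam * t).
Proof.
move=> cf k0 t0 fk; have [G dG GE] := antiderivative cf.
rewrite GE//.
have bound (sg : R) : `|sg| = 1 -> sg * (G t - G 0) <= k * expR (lam * t).
  move=> sg1.
  have [|s /andP[s0 st] sE] := @mean_value R
    (fun s => k * expR (lam * s) - sg * G s)
    (fun s => k * lam * expR (lam * s) - sg * f s) 0 t t0.
    move=> s /andP[s0 st]; have dGs := dG s s0.
    by apply: is_derive_eq; rewrite /= /GRing.scale /=; ring.
  have : 0 <= k * lam * expR (lam * s) - sg * f s.
    rewrite subr_ge0 (le_trans (ler_norm _))// normrM sg1 mul1r.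
    by apply: fk; rewrite s0.
  move=> d0; have := mulr_ge0 d0 t0; rewrite -[X in _ * X]subr0 -sE.
  by rewrite mulr0 expR0 mulr1; lra.
rewrite ler_norml; apply/andP; split.
  by have := bound (-1); rewrite normrN1 => /(_ erefl); lra.
by have := bound 1; rewrite normr1 mul1r => /(_ erefl).
Qed.

Variables (I : finType) (Phi : I -> (I -> R) -> R) (h : I -> R -> R) (K : R).
Hypothesis K0 : 0 <= K.
Hypothesis Phi_bound : forall i y, `|Phi i y| <= K.
Hypothesis Phi_lip :
  forall i y z, `|Phi i y - Phi i z| <= K * \sum_j `|y j - z j|.
Hypothesis h_lip :
  forall i s t, 0 <= s -> 0 <= t -> `|h i s - h i t| <= K * `|s - t|.

(** Freezing negative times at 0 makes every iterate Lipschitz on the whole line. *)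
Let pos (t : R) := Num.max 0 t.

Let pos_ge0 t : 0 <= pos t. Proof. by rewrite le_max lexx. Qed.

Let pos_id t : 0 <= t -> pos t = t. Proof. by move=> /max_idPr. Qed.

Let pos_lip s t : `|pos s - pos t| <= `|s - t|.
Proof.
have h1 := ler_norm (s - t); have h2 := ler_norm (t - s); rewrite distrC in h2.
rewrite ler_norml /pos.
by case: (leP 0 s) => ?; case: (leP 0 t) => ?; apply/andP; split; lra.
Qed.

Let lip (Y : R -> I -> R) :=
  forall i s t, `|Y s i - Y t i| <= 2 * K * `|s - t|.

Let picard (Y : R -> I -> R) t i :=
  h i (pos t) + Rintegral mu `[0, pos t] (fun s => Phi i (Y s)).

Let Phi_continuous Y i : lip Y -> continuous (fun s => Phi i (Y s)).
Proof.
move=> lY; apply: (@lipschitz_continuous R (K * (#|I|%:R * (2 * K)))) => s t.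
rewrite (le_trans (Phi_lip _ _ _))// -mulrA ler_wpM2l//.
rewrite (le_trans (ler_sum _ (fun j _ => lY j s t)))//.
by rewrite sumr_const -[leLHS]mulr_natl !mulrA.
Qed.

(** [h] contributes [K], and the integral another [K] because [Phi] is bounded by [K]. The constant
    [2 * K] is thus preserved; the regularity of [Y] only makes the integrand continuous. *)
Let picard_lip Y : lip Y -> lip (picard Y).
Proof.
move=> lY i s t.
have main a b : 0 <= a <= b ->
    `|Rintegral mu `[0, a] (fun s => Phi i (Y s)) -
      Rintegral mu `[0, b] (fun s => Phi i (Y s))| <= K * `|a - b|.
  move=> ab; rewrite distrC -RintegralB0//; last first.
    exact/continuous_integrable/Phi_continuous.
  rewrite (distrC a) (@ger0_norm _ (b - a)) ?subr_ge0 ?(proj2 (andP ab))//.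
  apply: Rintegral_bound => //; first exact: (proj2 (andP ab)).
  exact/continuous_integrable/Phi_continuous.
rewrite /picard opprD addrACA (le_trans (ler_normD _ _))//.
rewrite -mulrA mulrDl mul1r lerD//.
  by rewrite (le_trans (h_lip _ _ _))// ler_wpM2l.
rewrite (@le_trans _ _ (K * `|pos s - pos t|))//; last by rewrite ler_wpM2l.
have [st|/ltW st] := leP (pos s) (pos t); first by apply: main; rewrite pos_ge0.
by rewrite distrC (distrC (pos s)) main// pos_ge0.
Qed.

(** The Lipschitz sum costs at most [K * #|I|%:R <= lam / 2], so the weighted distance is halved.
    The [+ 1] gives [1 <= lam] even when [K = 0], for the first iteration step. *)
Let lam := 2 * (K * #|I|%:R + 1).

Let picard_contract Y Z c : 0 <= c -> lip Y -> lip Z ->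
  (forall t i, 0 <= t -> `|Y t i - Z t i| <= c * expR (lam * t)) ->
  forall t i, 0 <= t -> `|picard Y t i - picard Z t i| <= c / 2 * expR (lam * t).
Proof.
move=> c0 lY lZ YZ t i t0; rewrite /picard pos_id// opprD addrACA subrr add0r.
have cY := Phi_continuous (i := i) lY; have cZ := Phi_continuous (i := i) lZ.
rewrite -RintegralB//; try exact: continuous_integrable.
apply: exp_integral_bound => //.
- by move=> s; apply: cvgB; [exact: cY|exact: cZ].
- by rewrite divr_ge0.
move=> s /andP[s0 st]; rewrite (le_trans (Phi_lip _ _ _))//.
have : \sum_j `|Y s j - Z s j| <= #|I|%:R * (c * expR (lam * s)).
  rewrite (le_trans (ler_sum _ (fun j _ => YZ s j s0)))//.
  by rewrite sumr_const -[X in X <= _]mulr_natl.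
move=> /(ler_wpM2l K0) /le_trans; apply.
have e0 := expR_ge0 (lam * s).
have := mulr_ge0 c0 e0; rewrite /lam; set E := expR _; lra.
Qed.

(** The exponential weight makes the iteration converge on the whole half-line at once, with no
    continuation of local solutions. The discontinuous input will enter through its integral, in
    [h], of which only Lipschitz continuity is asked. *)
Lemma volterra_solution : exists Y : R -> I -> R,
  [/\ forall i s t, `|Y s i - Y t i| <= 2 * K * `|s - t|,
      forall i, continuous (fun s => Phi i (Y s)) &
      forall t i, 0 <= t ->
        Y t i = h i t + Rintegral mu `[0, t] (fun s => Phi i (Y s))].
Proof.
pose Y0 (t : R) i := h i (pos t).
pose Y_ k := iter k picard Y0.
have lipY k : lip (Y_ k).
  elim: k => [|k IH] /=; last exact: picard_lip.
  move=> i s t; rewrite (le_trans (h_lip _ _ _))//.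
  have := ler_wpM2l K0 (pos_lip s t).
  by have := mulr_ge0 K0 (normr_ge0 (s - t)); lra.
have lam1 : 1 <= lam.
  have : 0 <= K * #|I|%:R by rewrite mulr_ge0.
  by rewrite /lam; lra.
have stepY k t i : 0 <= t ->
    `|Y_ k.+1 t i - Y_ k t i| <= K * 2^-1 ^+ k * expR (lam * t).
  elim: k t i => [|k IH] t i t0.
    rewrite expr0 mulr1 /= /picard /Y0 pos_id// addrAC subrr add0r.
    have cPhi := Phi_continuous (i := i) (lipY 0%N).
    have := Rintegral_bound t0 (continuous_integrable 0 t cPhi)
      (fun s _ => Phi_bound i (Y0 s)).
    rewrite subr0 => /le_trans; apply; rewrite ler_wpM2l//.
    have : t <= lam * t by rewrite ler_peMl.
    by have := expR_ge1Dx (lam * t); lra.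
  rewrite exprSr mulrA.
  apply: (@picard_contract (Y_ k.+1) (Y_ k) _ _ (lipY k.+1) (lipY k) IH) => //.
  by rewrite mulr_ge0// exprn_ge0// invr_ge0.
have /choice[Y YE] : forall p : R * I, exists l, forall k,
    `|l - Y_ k (pos p.1) p.2| <= 2 * (K * expR (lam * pos p.1)) * 2^-1 ^+ k.
  move=> p; apply: (@geometric_limit R (fun k => Y_ k (pos p.1) p.2)) => m.
  by rewrite (le_trans (stepY m _ _ _))// mulrAC.
pose YY t i := Y (t, i).
have YYE t i k : 0 <= t -> `|YY t i - Y_ k t i| <= 2 * K * 2^-1 ^+ k * expR (lam * t).
  move=> t0; have := YE (t, i) k; rewrite /= pos_id// => /le_trans; apply.
  by rewrite le_eqVlt; apply/orP; left; apply/eqP; ring.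
pose Z t i := YY (pos t) i.
have ZE t i k : 0 <= t -> `|Z t i - Y_ k t i| <= 2 * K * 2^-1 ^+ k * expR (lam * t).
  by move=> t0; rewrite /Z pos_id//; exact: YYE.
have lipZ : lip Z.
  move=> i s t; apply: (@le_of_geometric _ _ _
    (2 * K * (expR (lam * pos s) + expR (lam * pos t)))) => k.
  rewrite /Z; have := YYE (pos s) i k (pos_ge0 s).
  have := YYE (pos t) i k (pos_ge0 t).
  have := lipY k i (pos s) (pos t).
  have : 2 * K * `|pos s - pos t| <= 2 * K * `|s - t| by rewrite ler_wpM2l// mulr_ge0.
  rewrite !ler_norml => ? /andP[? ?] /andP[? ?] /andP[? ?].
  by apply/andP; split; lra.
exists Z; split=> [//|i|]; first exact: Phi_continuous.
move=> t i t0; have -> : h i t + Rintegral mu `[0, t] (fun s => Phi i (Z s)) = picard Z t i.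
  by rewrite /picard pos_id.
apply/eqP; rewrite -subr_eq0 -normr_eq0 eq_le normr_ge0 andbT.
(* Both [Z t i] and [picard Z t i] lie within [K * 2^-1 ^+ k * expR (lam * t)] of the iterate of
   rank [k.+1]. *)
apply: (@le_of_geometric _ _ _ (3 * K * expR (lam * t))) => k; rewrite add0r.
have c0 : 0 <= 2 * K * 2^-1 ^+ k.
  by rewrite !mulr_ge0// exprn_ge0// invr_ge0.
have := picard_contract c0 lipZ (lipY k) (fun t i t0 => ZE t i k t0) i t0.
have := ZE t i k.+1 t0; rewrite /= exprS.
rewrite !ler_norml => /andP[? ?] /andP[? ?].
have E0 : 0 <= K * 2^-1 ^+ k * expR (lam * t).
  by rewrite !mulr_ge0 ?expR_ge0// exprn_ge0// invr_ge0.
by apply/andP; split; lra.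
Qed.

End Volterra.

(** * Stability and convergence *)

Lemma entry_le_norm (R : realType) n (v : 'cV[R]_n) i : `|v i 0| <= `|v|.
Proof.
rewrite [leRHS]mx_normrE.
exact: (le_bigmax _ (fun ij : 'I_n * 'I_1 => `|v ij.1 ij.2|) (i, 0)).
Qed.

Lemma norm_le_entries (R : realType) n (v : 'cV[R]_n) c : 0 <= c ->
  (forall i, `|v i 0| <= c) -> `|v| <= c.
Proof.
move=> c0 vc; rewrite [leLHS]mx_normrE; apply: bigmax_le => // -[i j] _ /=.
by rewrite ord1.
Qed.

Lemma norm_le_sqr (R : realDomainType) (y c : R) : 0 <= c -> y ^+ 2 <= c ^+ 2 -> `|y| <= c.
Proof. by move=> c0; rewrite -[y ^+ 2]real_normK ?num_real// ler_sqr ?nnegrE. Qed.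

(** Past a time where [f] is within [eps] of its infimum, the total remaining drop is at most [eps].
    Applied to the energy, this plays the part of the finite integral of e^T e. *)
Lemma nonincreasing_tail (R : realType) (f : R -> R) (eps : R) : 0 < eps ->
  (forall t, 0 <= t -> 0 <= f t) ->
  (forall s t, 0 <= s <= t -> f t <= f s) ->
  exists2 t0, 0 <= t0 & forall s t, t0 <= s <= t -> f s - f t <= eps.
Proof.
move=> eps0 f0 fdec; pose S := f @` [set t | 0 <= t].
have infS : has_inf S.
  split; first by exists (f 0); exists 0 => //=.
  by exists 0 => _ [t t0 <-]; exact: f0.
have [_ [t0 t0_ge0 <-] ft0] := inf_adherent eps0 infS.
exists t0 => // s t /andP[t0s st].
have h1 : f s <= f t0 by rewrite fdec// t0_ge0.
have h2 : inf S <= f t.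
  by apply: ge_inf; [exact: infS.2|exists t => //=; exact: le_trans t0_ge0 (le_trans t0s st)].
lra.
Qed.

Lemma ode_on_lipschitz (R : realType) n (T : \bar R) (X F : R -> 'cV[R]_n) (K s t : R) i :
  ode_on T X F -> 0 <= s <= t -> (t%:E < T)%E ->
  (forall u, s <= u <= t -> `|F u i 0| <= K) -> `|X t i 0 - X s i 0| <= K * (t - s).
Proof.
move=> odeX /andP[s0 st] tT FK; have t0 := le_trans s0 st.
have sT : (s%:E < T)%E by rewrite (le_lt_trans _ tT)// lee_fin.
have [intF ->] := odeX t t0 tT i; have [_ ->] := odeX s s0 sT i.
rewrite opprD addrACA subrr add0r -RintegralB0 ?s0//.
apply: Rintegral_bound => //; apply: integrableS intF => //.
by apply: subset_itvr; rewrite bnd_simp.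
Qed.

Lemma dot_bound (R : realFieldType) n (u v : 'cV[R]_n) (a c : R) :
  0 <= a -> (forall i, `|u i 0| <= a) -> (forall i, `|v i 0| <= c) ->
  `|(u^T *m v) 0 0| <= n%:R * (a * c).
Proof.
move=> a0 ua vc; rewrite mxE (le_trans (ler_norm_sum _ _ _))//.
apply: (@le_trans _ _ (\sum_(i < n) a * c)).
  by apply: ler_sum => i _; rewrite mxE normrM ler_pM.
by rewrite sumr_const card_ord -[leLHS]mulr_natl.
Qed.

Section Stability.
Variables (R : realType) (n : nat) (Ap : 'M[R]_n) (b : 'cV[R]_n).
Variables (Am L Gamma P : 'M[R]_n) (r : R -> R) (theta_star : 'cV[R]_n).
Hypotheses (hGamma : sym_posdef Gamma) (hP : sym_posdef P).
Hypothesis hLyap : (Am + L)^T *m P + P *m (Am + L) = - 1%:M.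
Hypothesis hmatch : Am = Ap + b *m theta_star^T.
Let loop := closed_loop Ap b Am L Gamma P r.

(** One gain, linear in the size of the initial data, serves both Lyapunov stability and the bounds
    for data of any size. *)
Lemma uniform_stability : exists2 kappa : R, 0 < kappa &
  forall (T : \bar R) (x xm theta : R -> 'cV[R]_n) (delta : R), loop T x xm theta ->
    `|x 0 - xm 0| <= delta -> `|theta 0 - theta_star| <= delta ->
    forall t : R, 0 <= t -> (t%:E < T)%E ->
      `|x t - xm t| <= kappa * delta /\ `|theta t - theta_star| <= kappa * delta.
Proof.
pose S := \sum_i \sum_j `|P i j| + \sum_i \sum_j `|invmx Gamma i j|.
have S0 : 0 <= S by rewrite addr_ge0// sumr_ge0// => i _; exact: sumr_ge0.
pose q := \sum_i `|invmx P i i| + \sum_i `|Gamma i i|.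
have q0 : 0 <= q by rewrite addr_ge0// sumr_ge0.
have qP i : invmx P i i <= q.
  rewrite (le_trans (ler_norm _))// /q (bigD1 i)//= -addrA lerDl addr_ge0//.
    exact: sumr_ge0.
  exact: sumr_ge0.
have qG i : Gamma i i <= q.
  rewrite (le_trans (ler_norm _))// /q [X in _ + X](bigD1 i)//= addrCA lerDl.
  by rewrite addr_ge0// sumr_ge0.
have qS0 : 0 <= q * S by rewrite mulr_ge0.
(* The initial energy is at most [S * (delta * delta)] and each squared coordinate at most [q] times
   the energy; [1 + q * S] dominates the square root of [q * S]. *)
exists (1 + q * S); first by rewrite ltr_pwDl.
move=> T x xm theta delta CL e0 th0 t t0 tT.
have d0 : 0 <= delta by rewrite (le_trans _ e0).
have V0 : energy Gamma P theta_star (x 0 - xm 0) (theta 0) <= S * (delta * delta).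
  rewrite mulrDl lerD// (le_trans (ler_norm _))// bil_bound// => i.
  - by rewrite (le_trans (entry_le_norm _ _)).
  - by rewrite (le_trans (entry_le_norm _ _)).
  - by rewrite (le_trans (entry_le_norm _ _)).
  - by rewrite (le_trans (entry_le_norm _ _)).
have := energy_nonincreasing hGamma hP hLyap hmatch CL _ tT.
move=> /(_ 0); rewrite lexx t0 => /(_ isT) Vt.
have {V0}Vt := le_trans Vt V0.
set V := energy _ _ _ _ _ in Vt.
have V_ge0 : 0 <= V by exact: energy_ge0.
have final (y a : R) : a <= q -> y ^+ 2 <= a * V -> `|y| <= (1 + q * S) * delta.
  move=> aq yV; apply: norm_le_sqr; first by rewrite mulr_ge0// addr_ge0.
  have h1 : a * V <= q * V by rewrite ler_wpM2r.
  have h2 : q * V <= q * (S * (delta * delta)) by rewrite ler_wpM2l.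
  have h3 : 0 <= delta * delta by rewrite mulr_ge0.
  have h4 : 0 <= (q * S) * (q * S) * (delta * delta) by rewrite !mulr_ge0.
  have h5 : 0 <= (q * S) * (delta * delta) by rewrite !mulr_ge0.
  rewrite (le_trans yV)// (le_trans h1)// (le_trans h2)// mulrA.
  have -> : ((1 + q * S) * delta) ^+ 2 = q * S * (delta * delta) +
    (delta * delta + q * S * (delta * delta) +
     q * S * (q * S) * (delta * delta)) by ring.
  by rewrite lerDl !addr_ge0.
have kd0 : 0 <= (1 + q * S) * delta by rewrite mulr_ge0// addr_ge0.
split; apply: norm_le_entries => // i.
  by apply: final (qP i) _; exact: error_sqr_le.
by apply: final (qG i) _; exact: gain_sqr_le.
Qed.

Hypothesis hAm : hurwitz Am.
Variable M : R.
Hypotheses (M0 : 0 <= M) (rM : forall t, 0 <= t -> `|r t| <= M).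

Lemma uniform_boundedness (rho : R) : exists C : R,
  forall (T : \bar R) (x xm theta : R -> 'cV[R]_n), loop T x xm theta ->
    `|x 0| <= rho -> `|xm 0| <= rho -> `|theta 0| <= rho ->
    forall t : R, 0 <= t -> (t%:E < T)%E ->
      [/\ `|x t| <= C, `|xm t| <= C, `|theta t| <= C
        & `|control r x theta t| <= C].
Proof.
have [kappa kappa0 stab] := uniform_stability.
(* This covers both the initial error, at most twice [rho], and the initial gain error. *)
pose delta := `|rho| + `|rho| + `|theta_star|.
have d0 : 0 <= delta by rewrite !addr_ge0.
pose E := kappa * delta; have E0 : 0 <= E by rewrite mulr_ge0// ltW.
(* The first two terms bound the forcing [r b - L e] of the reference model, the last one its
   initial state. *)
pose K := M * `|b| + (\sum_i \sum_j `|L i j|) * E + `|rho|.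
have nL0 : 0 <= \sum_i \sum_j `|L i j| by apply: sumr_ge0 => i _; exact: sumr_ge0.
have K0 : 0 <= K by rewrite !addr_ge0// mulr_ge0.
have [C0 C0P] := bibo hAm K0.
pose Cm := `|C0|; pose Cx := E + Cm; pose Cth := E + `|theta_star|.
have Cm0 : 0 <= Cm := normr_ge0 _.
have Cx0 : 0 <= Cx by rewrite addr_ge0.
have Cth0 : 0 <= Cth by rewrite addr_ge0.
pose Cu := n%:R * (Cth * Cx) + M.
have Cu0 : 0 <= Cu by rewrite addr_ge0// !mulr_ge0.
exists (Cx + Cth + Cu) => T x xm theta CL x0 xm0 th0 t t0 tT.
have rho_le : rho <= `|rho| := ler_norm _.
have bounds s : 0 <= s -> (s%:E < T)%E ->
    `|x s - xm s| <= E /\ `|theta s - theta_star| <= E.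
  apply: (stab _ _ _ _ _ CL).
    rewrite (le_trans (ler_normB _ _))// /delta -[leLHS]addr0.
    by rewrite !lerD// (le_trans _ rho_le).
  rewrite (le_trans (ler_normB _ _))// /delta lerD//.
  by rewrite (le_trans th0)// (le_trans rho_le)// lerDl.
have [et tht] := bounds t t0 tT.
have xmt : `|xm t| <= Cm.
  apply: norm_le_entries => // i; rewrite (le_trans _ (ler_norm C0))//.
  have [_ + _] := CL; rewrite (_ : (fun t => _) =
      (fun t => Am *m xm t + (r t *: b - L *m (x t - xm t)))); last first.
    by apply/funext => s; rewrite addrA.
  move=> /C0P; apply => //.
    move=> s j s0 sT; rewrite mxE (le_trans (ler_normD _ _))// -[leLHS]addr0.
    rewrite !lerD//.
      by rewrite mxE normrM ler_pM// ?rM// entry_le_norm.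
    rewrite mxE normrN; apply: mulmx_entry_bound => // k.
    by rewrite (le_trans (entry_le_norm _ _))// (bounds s s0 sT).1.
  move=> j; rewrite (le_trans (entry_le_norm _ _))// (le_trans xm0)//.
  rewrite (le_trans rho_le)// lerDr addr_ge0// mulr_ge0//.
have xt : `|x t| <= Cx.
  by rewrite -[x t](subrK (xm t)) (le_trans (ler_normD _ _))// lerD.
have tht' : `|theta t| <= Cth.
  by rewrite -[theta t](subrK theta_star) (le_trans (ler_normD _ _))// lerD.
have ut : `|control r x theta t| <= Cu.
  rewrite /control (le_trans (ler_normD _ _))// lerD ?rM//.
  by apply: dot_bound => // i; rewrite (le_trans (entry_le_norm _ _)).
have CmCx : Cm <= Cx by rewrite lerDr.
have CxC : Cx <= Cx + Cth + Cu by rewrite -addrA lerDl addr_ge0.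
split; first exact: le_trans CxC.
- exact: le_trans (le_trans xmt CmCx) CxC.
- by rewrite (le_trans tht')// addrAC lerDr addr_ge0.
- by rewrite (le_trans ut)// lerDr addr_ge0.
Qed.

(* The energy dissipated on [t, t + d] is at least d times the minimum of the
   squared error there, while the error is Lipschitz. *)
Lemma error_vanishes (x xm theta : R -> 'cV[R]_n) : loop +oo%E x xm theta ->
  x t - xm t @[t --> +oo%R] --> (0 : 'cV[R]_n).
Proof.
move=> CL; pose rho := `|x 0| + `|xm 0| + `|theta 0|.
have [C CP] := uniform_boundedness rho.
have bd (t : R) : 0 <= t -> [/\ `|x t| <= C, `|xm t| <= C, `|theta t| <= C
                               & `|control r x theta t| <= C].
  move=> t0; apply: (CP _ _ _ _ CL); rewrite ?ltry// /rho.
  - by rewrite -addrA lerDl addr_ge0.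
  - by rewrite addrAC lerDr addr_ge0.
  - by rewrite lerDr addr_ge0.
have C0 : 0 <= C by have [+ _ _ _] := bd 0 (lexx _); exact: le_trans.
pose e (t : R) := x t - xm t.
have eE (t : R) i : 0 <= t -> `|e t i 0| <= 2 * C.
  move=> /bd[xC xmC _ _]; rewrite (le_trans (entry_le_norm _ _))//.
  by rewrite (le_trans (ler_normB _ _))//; lra.
pose nA := \sum_i \sum_j `|(Am + L) i j|.
have nA0 : 0 <= nA by apply: sumr_ge0 => i _; exact: sumr_ge0.
pose Kf := nA * (2 * C) + n%:R * ((C + `|theta_star|) * C) * `|b|.
have Ct0 : 0 <= C + `|theta_star| by rewrite addr_ge0.
have Kf0 : 0 <= Kf by rewrite addr_ge0 ?mulr_ge0.
have elip (s t : R) i : 0 <= s <= t -> `|e t i 0 - e s i 0| <= Kf * (t - s).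
  move=> st; have [ode_x ode_xm _] := CL.
  apply: (ode_on_lipschitz (ode_onB ode_x ode_xm) st (ltry t)) => u /andP[su _].
  have u0 : 0 <= u by case/andP: st => s0 _; exact: le_trans su.
  have [xC _ thC _] := bd u u0.
  rewrite /control (error_rate L hmatch) mxE (le_trans (ler_normD _ _))// lerD//.
    by apply: mulmx_entry_bound => [|j]; [exact: mulr_ge0|exact: eE].
  rewrite mxE normrM ler_pM ?entry_le_norm//; apply: dot_bound => // j.
    rewrite (le_trans (entry_le_norm _ _))// (le_trans (ler_normB _ _))//.
    by rewrite lerD.
  by rewrite (le_trans (entry_le_norm _ _)).
apply/cvgrPdist_le => eps eps0.
(* Over a time [d], a squared coordinate of [e] varies by at most [Kf * d * (4 * C)], which must not
   exceed [eps ^+ 2 / 2]; the [+ 1] guards against [C * Kf = 0]. *)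
pose d := eps ^+ 2 / (8 * (C * Kf + 1)).
have CK0 : 0 <= C * Kf by rewrite mulr_ge0.
have eps20 : 0 < eps ^+ 2 by rewrite exprn_gt0.
have d0 : 0 < d by rewrite divr_gt0// mulr_gt0// ltr_wpDl.
have dE : 4 * C * Kf * d <= eps ^+ 2 / 2.
  rewrite /d mulrA ler_pdivrMr; last by rewrite mulr_gt0// ltr_wpDl.
  by have := mulr_ge0 (ltW eps20) CK0; lra.
pose V t := energy Gamma P theta_star (e t) (theta t).
(* On a late window of length [d] the energy drops by [d] times the squared error at some point [c];
   this threshold forces that squared error below [eps ^+ 2 / 2]. *)
have [|||t0 t0_ge0 Vtail] := @nonincreasing_tail R V (d * (eps ^+ 2 / 2)).
- by rewrite mulr_gt0// divr_gt0.
- by move=> t _; exact: energy_ge0.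
- by move=> s t st; apply: (energy_nonincreasing hGamma hP hLyap hmatch CL st); rewrite ltry.
near=> t; have t0t : t0 <= t by near: t; apply: nbhs_pinfty_ge; rewrite num_real.
have t_ge0 : 0 <= t := le_trans t0_ge0 t0t.
rewrite sub0r normrN; apply: norm_le_entries => [|i]; first exact: ltW.
apply: norm_le_sqr; first exact: ltW.
have [|c /andP[tc ctd]] := energy_mean_value hGamma hP hLyap hmatch CL _ (ltry (t + d)) (s := t).
  by rewrite t_ge0 lerDl ltW.
rewrite -/(V t) -/(V (t + d)) -/(e c) (_ : t + d - t = d) => [VE|]; last by ring.
have ec : bil 1%:M (e c) (e c) <= eps ^+ 2 / 2.
  have := Vtail t (t + d); rewrite t0t lerDl (ltW d0) => /(_ isT).
  by move=> Vle; rewrite -(ler_pM2l d0); lra.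
have eci : e c i 0 ^+ 2 <= eps ^+ 2 / 2.
  rewrite (le_trans _ ec)// bil1E (bigD1 i)//= lerDl sumr_ge0// => j _.
  exact: sqr_ge0.
have := elip t c i; rewrite t_ge0 tc => /(_ isT).
have := eE t i t_ge0; have := eE c i (le_trans t_ge0 tc).
rewrite -/(e t).
move: (e t i 0) (e c i 0) eci => y z zle zC yC yz.
have yzd : `|z - y| <= Kf * d.
  by rewrite (le_trans yz)// ler_wpM2l// lerBlDl.
(* Since [y ^+ 2] is [z ^+ 2] plus this product, it is at most twice [eps ^+ 2 / 2]. *)
have : `|(y - z) * (y + z)| <= Kf * d * (4 * C).
  rewrite normrM; apply: ler_pM => //; first by rewrite distrC.
  by rewrite (le_trans (ler_normD _ _))//; lra.
by move=> /(le_trans (ler_norm _)); lra.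
Unshelve. all: by end_near. Qed.

End Stability.

(** * Global existence *)

Section BoundedLipschitz.
Variables (R : realType) (I : finType).
Implicit Types f g : (I -> R) -> R.

(** Boundedness is bundled with the Lipschitz condition so that products stay in the class; a
    polynomial field in clamped coordinates then belongs to it by closure. *)
Definition bounded_lipschitz f := exists K : R,
  [/\ 0 <= K, forall y, `|f y| <= K &
      forall y z, `|f y - f z| <= K * \sum_j `|y j - z j|].

Let dist_ge0 (y z : I -> R) : 0 <= \sum_j `|y j - z j|.
Proof. exact: sumr_ge0. Qed.

Lemma bounded_lipschitz_cst c : bounded_lipschitz (fun=> c).
Proof.
by exists `|c|; split=> // y z; rewrite subrr normr0 mulr_ge0.
Qed.

Lemma bounded_lipschitzD f g : bounded_lipschitz f -> bounded_lipschitz g ->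
  bounded_lipschitz (fun y => f y + g y).
Proof.
move=> [K [K0 fK lf]] [K' [K'0 gK lg]]; exists (K + K'); split.
- exact: addr_ge0.
- by move=> y; rewrite (le_trans (ler_normD _ _))// lerD.
- move=> y z; rewrite opprD addrACA (le_trans (ler_normD _ _))// mulrDl.
  exact: lerD.
Qed.

Lemma bounded_lipschitzM f g : bounded_lipschitz f -> bounded_lipschitz g ->
  bounded_lipschitz (fun y => f y * g y).
Proof.
move=> [K [K0 fK lf]] [K' [K'0 gK lg]]; exists (2 * (K * K')).
have KK : 0 <= K * K' by exact: mulr_ge0.
split.
- exact: mulr_ge0.
- move=> y; rewrite normrM (@le_trans _ _ (K * K'))//; first exact: ler_pM.
  by rewrite ler_peMl// ler1n.
- move=> y z; have -> : f y * g y - f z * g z =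
      f y * (g y - g z) + (f y - f z) * g z by ring.
  rewrite (le_trans (ler_normD _ _))// !normrM.
  have h1 := ler_pM (normr_ge0 _) (normr_ge0 _) (fK y) (lg y z).
  have h2 := ler_pM (normr_ge0 _) (normr_ge0 _) (lf y z) (gK z).
  rewrite (le_trans (lerD h1 h2))// le_eqVlt; apply/orP; left; apply/eqP; ring.
Qed.

Lemma bounded_lipschitz_sum (J : finType) (f : J -> (I -> R) -> R) :
  (forall j, bounded_lipschitz (f j)) ->
  bounded_lipschitz (fun y => \sum_j f j y).
Proof.
move=> lf; elim: (index_enum J) => [|j s IH].
  under eq_fun do rewrite big_nil; exact: bounded_lipschitz_cst.
by under eq_fun do rewrite big_cons; exact: bounded_lipschitzD.
Qed.

Lemma bounded_lipschitz_clamp (B : R) j : 0 <= B ->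
  bounded_lipschitz (fun y => clamp (- B) B (y j)).
Proof.
move=> B0; exists (B + 1); split.
- by rewrite addr_ge0.
- move=> y; rewrite (@le_trans _ _ B) ?lerDl// ler_norml clamp_ge clamp_le//.
  by rewrite ge0_cp.
- move=> y z; rewrite (le_trans (clamp_lipschitz _ _ _ _))//.
  rewrite (@le_trans _ _ (\sum_j `|y j - z j|))//.
    by rewrite (bigD1 j)//= lerDl sumr_ge0.
  by rewrite ler_peMl// lerDr.
Qed.

Definition bounded_lipschitz_mx m n (F : (I -> R) -> 'M[R]_(m, n)) :=
  forall i j, bounded_lipschitz (fun y => F y i j).

Lemma bounded_lipschitz_mx_cst m n (A : 'M[R]_(m, n)) :
  bounded_lipschitz_mx (fun=> A).
Proof. by move=> i j; exact: bounded_lipschitz_cst. Qed.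

Lemma bounded_lipschitz_mxD m n (F G : (I -> R) -> 'M[R]_(m, n)) :
  bounded_lipschitz_mx F -> bounded_lipschitz_mx G ->
  bounded_lipschitz_mx (fun y => F y + G y).
Proof.
by move=> lF lG i j; under eq_fun do rewrite mxE; exact: bounded_lipschitzD.
Qed.

Lemma bounded_lipschitz_mxZ m n (f : (I -> R) -> R) (F : (I -> R) -> 'M[R]_(m, n)) :
  bounded_lipschitz f -> bounded_lipschitz_mx F ->
  bounded_lipschitz_mx (fun y => f y *: F y).
Proof.
by move=> lf lF i j; under eq_fun do rewrite mxE; exact: bounded_lipschitzM.
Qed.

Lemma bounded_lipschitz_mxN m n (F : (I -> R) -> 'M[R]_(m, n)) :
  bounded_lipschitz_mx F -> bounded_lipschitz_mx (fun y => - F y).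
Proof.
move=> lF; under eq_fun do rewrite -scaleN1r.
by apply: bounded_lipschitz_mxZ => //; exact: bounded_lipschitz_cst.
Qed.

Lemma bounded_lipschitz_mxM m n p (F : (I -> R) -> 'M[R]_(m, n))
    (G : (I -> R) -> 'M[R]_(n, p)) :
  bounded_lipschitz_mx F -> bounded_lipschitz_mx G ->
  bounded_lipschitz_mx (fun y => F y *m G y).
Proof.
move=> lF lG i j; under eq_fun do rewrite mxE.
by apply: bounded_lipschitz_sum => k; exact: bounded_lipschitzM.
Qed.

Lemma bounded_lipschitz_mx_tr m n (F : (I -> R) -> 'M[R]_(m, n)) :
  bounded_lipschitz_mx F -> bounded_lipschitz_mx (fun y => (F y)^T).
Proof. by move=> lF i j; under eq_fun do rewrite mxE; exact: lF. Qed.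

End BoundedLipschitz.

Section Existence.
Variables (R : realType) (n : nat) (Ap : 'M[R]_n) (b : 'cV[R]_n).
Variables (Am L Gamma P : 'M[R]_n) (r : R -> R).
Notation mu := (@lebesgue_measure R).
Variable M : R.
Hypotheses (M0 : 0 <= M) (rM : forall t, 0 <= t -> `|r t| <= M).
Hypothesis mr : measurable_fun (`[0, +oo[ : set R) r.

Lemma input_integrable (t : R) : mu.-integrable `[0, t] (EFin \o r).
Proof.
apply: measurable_bounded_integrable => //=.
- by rewrite lebesgue_measure_itv/=; case: ifP => // _; rewrite -EFinD ltry.
- apply: measurable_funS mr => //; apply: subset_itvl; rewrite bnd_simp//.
- exists M; split; first exact: num_real.
  move=> m Mm s /=; rewrite in_itv/= => /andP[s0 _].
  by rewrite (le_trans (rM s0))// ltW.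
Qed.

Let rho (t : R) := Rintegral mu `[0, t] r.

Lemma integrated_input_lipschitz (s t : R) : 0 <= s -> 0 <= t ->
  `|rho s - rho t| <= M * `|s - t|.
Proof.
wlog st : s t / s <= t.
  move=> H s0 t0; have [st|/ltW ts] := leP s t; first exact: H.
  by rewrite distrC (distrC s) H.
move=> s0 t0; rewrite distrC -RintegralB0 ?s0//; last exact: input_integrable.
rewrite (distrC s) (@ger0_norm _ (t - s)) ?subr_ge0//.
apply: Rintegral_bound => //.
  apply: integrableS (input_integrable t) => //.
  by apply: subset_itvr; rewrite bnd_simp.
by move=> u /andP[su _]; apply: rM; exact: le_trans su.
Qed.

(** Applied with [c = b i 0] to the plant and the reference model, and with [c = 0] to the gain. *)
Lemma forced_integral (g F : R -> R) (c t : R) : continuous g ->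
  (forall s, 0 <= s <= t -> F s = g s + r s * c) ->
  mu.-integrable `[0, t] (EFin \o F) /\
  Rintegral mu `[0, t] F = Rintegral mu `[0, t] g + rho t * c.
Proof.
move=> cg FE; have ig := continuous_integrable 0 t cg.
have ir : mu.-integrable `[0, t] (EFin \o (fun s => r s * c)).
  by apply: (integrableZr _ c (input_integrable t)).
have FE' : {in `[0, t]%classic, (fun s => g s + r s * c) =1 F}.
  by move=> s /[!inE]/=; rewrite in_itv/= => st; rewrite FE.
split.
  apply: (@eq_integrable _ _ _ mu _ _ (EFin \o (fun s => g s + r s * c))) => //.
    by move=> s /FE' /= ->.
  by apply: (integrableD _ ig ir).
rewrite (_ : Rintegral mu _ F = Rintegral mu `[0, t] (fun s => g s + r s * c)); last first.
  by apply: eq_Rintegral => s /FE' <-.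
rewrite RintegralD// RintegralZr//.
exact: input_integrable.
Qed.

Variables (x0 xm0 th0 : 'cV[R]_n) (C : R).
Hypothesis a_priori : forall (T : \bar R) (x xm theta : R -> 'cV[R]_n),
  closed_loop Ap b Am L Gamma P r T x xm theta ->
  x 0 = x0 -> xm 0 = xm0 -> theta 0 = th0 ->
  forall t : R, 0 <= t -> (t%:E < T)%E ->
    [/\ `|x t| <= C, `|xm t| <= C & `|theta t| <= C].

(* The right-hand side is evaluated at the state clamped to [-B, B]: this makes
   it bounded and Lipschitz, and the a priori bound keeps the clamp inactive. *)
Lemma global_solution : exists x xm theta : R -> 'cV[R]_n,
  closed_loop Ap b Am L Gamma P r +oo%E x xm theta /\
  [/\ x 0 = x0, xm 0 = xm0 & theta 0 = th0].
Proof.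
pose C' := `|C| + `|x0| + `|xm0| + `|th0|.
have C'0 : 0 <= C' by rewrite !addr_ge0.
(* [C'] dominates the a priori bound and the initial data; the margin 1 lets the state move for a
   fixed time before it can reach the clamp. *)
pose B := C' + 1; have B0 : 0 <= B by rewrite addr_ge0.
pose St := ('I_n + 'I_n + 'I_n)%type.
pose part (k : 'I_n -> St) (y : St -> R) : 'cV[R]_n := \col_i clamp (- B) B (y (k i)).
pose ix i : St := inl (inl i); pose im i : St := inl (inr i); pose it i : St := inr i.
(* The input is left out of the fields; its integral [rho] goes into [h], together with the initial
   data. *)
pose Fx y := Ap *m part ix y + ((part it y)^T *m part ix y) 0 0 *: b.
pose Fm y := Am *m part im y - L *m (part ix y - part im y).
pose Ft y := - (Gamma *m part ix y *m (part ix y - part im y)^T *m P *m b).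
pose Phi (j : St) y := match j with
  | inl (inl i) => Fx y i 0 | inl (inr i) => Fm y i 0 | inr i => Ft y i 0 end.
pose h (j : St) t := match j with
  | inl (inl i) => x0 i 0 + rho t * b i 0 | inl (inr i) => xm0 i 0 + rho t * b i 0
  | inr i => th0 i 0 end.
have blP k : bounded_lipschitz_mx (part k).
  move=> i j; under eq_fun do rewrite mxE; exact: bounded_lipschitz_clamp.
have blC m p (A : 'M[R]_(m, p)) := @bounded_lipschitz_mx_cst R St m p A.
have blE : bounded_lipschitz_mx (fun y => part ix y - part im y).
  by apply: bounded_lipschitz_mxD => //; exact: bounded_lipschitz_mxN.
have blPhi j : bounded_lipschitz (Phi j).
  (* Generalizing the column index 0 turns the goal into [bounded_lipschitz_mx], on which the matrix
     closure lemmas act. *)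
  case: j => [[i|i]|i]; rewrite /Phi; move: i (0 : 'I_1).
  - apply: bounded_lipschitz_mxD; first exact: bounded_lipschitz_mxM.
    apply: bounded_lipschitz_mxZ => //; apply: bounded_lipschitz_mxM => //.
    exact: bounded_lipschitz_mx_tr.
  - apply: bounded_lipschitz_mxD; first exact: bounded_lipschitz_mxM.
    apply: bounded_lipschitz_mxN; exact: bounded_lipschitz_mxM.
  - apply: bounded_lipschitz_mxN; do 3![apply: bounded_lipschitz_mxM => //].
      exact: bounded_lipschitz_mxM.
    exact: bounded_lipschitz_mx_tr.
have /choice[KPhi KPhiE] := blPhi.
pose K := \sum_j KPhi j + M * `|b|.
have sK0 : 0 <= \sum_j KPhi j.
  by apply: sumr_ge0 => j _; have [] := KPhiE j.
have Mb0 : 0 <= M * `|b| by exact: mulr_ge0.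
have K0 : 0 <= K by exact: addr_ge0.
have KPhiK j : KPhi j <= K.
  rewrite /K (bigD1 j)//= -addrA lerDl addr_ge0// sumr_ge0// => k _.
  by have [] := KPhiE k.
have hlip j s t : 0 <= s -> 0 <= t -> `|h j s - h j t| <= K * `|s - t|.
  move=> s0 t0.
  have Hb c i : `|c + rho s * b i 0 - (c + rho t * b i 0)| <= K * `|s - t|.
    have -> : c + rho s * b i 0 - (c + rho t * b i 0) = (rho s - rho t) * b i 0 by ring.
    rewrite normrM (@le_trans _ _ (M * `|s - t| * `|b|))//.
      by apply: ler_pM; rewrite ?entry_le_norm// integrated_input_lipschitz.
    by rewrite mulrAC ler_wpM2r// lerDr.
  by case: j => [[i|i]|i] /=; rewrite ?Hb// subrr normr0 mulr_ge0.
have [||Y [Ylip cPhi YE]] := @volterra_solution R _ Phi h K K0 _ _ hlip.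
- by move=> j y; have [_ + _] := KPhiE j => /(_ y) /le_trans; apply.
- move=> j y z; have [_ _ /(_ y z) /le_trans] := KPhiE j; apply.
  by rewrite ler_wpM2r// sumr_ge0.
pose x t : 'cV[R]_n := \col_i Y t (ix i).
pose xm t : 'cV[R]_n := \col_i Y t (im i).
pose th t : 'cV[R]_n := \col_i Y t (it i).
have rho0 : rho 0 = 0 by rewrite /rho set_itv1 Rintegral_set1.
have Y0 j : Y 0 j = h j 0 by rewrite YE// set_itv1 Rintegral_set1 addr0.
have xE : x 0 = x0.
  by apply/matrixP => i j; rewrite ord1 mxE Y0 /= rho0 mul0r addr0.
have xmE : xm 0 = xm0.
  by apply/matrixP => i j; rewrite ord1 mxE Y0 /= rho0 mul0r addr0.
have thE : th 0 = th0 by apply/matrixP => i j; rewrite ord1 mxE Y0.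
have CL (T : \bar R) : (forall t j, 0 <= t -> (t%:E < T)%E -> `|Y t j| <= B) ->
    closed_loop Ap b Am L Gamma P r T x xm th.
  move=> YB.
  have partE k s : 0 <= s -> (s%:E < T)%E -> part k (Y s) = \col_i Y s (k i).
    move=> s0 sT; apply/matrixP => i j; rewrite !mxE clamp_id//.
    by rewrite -ler_norml; exact: YB.
  have inT s t : 0 <= s <= t -> (t%:E < T)%E -> (s%:E < T)%E.
    by move=> /andP[_ st]; apply: le_lt_trans; rewrite lee_fin.
  split=> t t0 tT i.
  - have [|intF FE] := @forced_integral (fun s => Phi (ix i) (Y s))
      (fun s => (Ap *m x s + control r x th s *: b) i 0) (b i 0) t (cPhi (ix i)).
      move=> s st; have sT := inT s t st tT; have s0 := proj1 (andP st).
      rewrite /Phi /= /Fx !partE// -/(x s) -/(th s) /control.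
      by rewrite scalerDl addrA mxE [(_ *: b) i 0]mxE.
    split=> //; rewrite FE xE mxE YE//= [RHS]addrA; ring.
  - have [|intF FE] := @forced_integral (fun s => Phi (im i) (Y s))
      (fun s => (Am *m xm s + r s *: b - L *m (x s - xm s)) i 0) (b i 0) t (cPhi (im i)).
      move=> s st; have sT := inT s t st tT; have s0 := proj1 (andP st).
      rewrite /Phi /= /Fm !partE// -/(x s) -/(xm s).
      by rewrite addrAC mxE [(_ *: b) i 0]mxE.
    split=> //; rewrite FE xmE mxE YE//=; ring.
  - have [|intF FE] := @forced_integral (fun s => Phi (it i) (Y s))
      (fun s => (- (Gamma *m x s *m (x s - xm s)^T *m P *m b)) i 0) 0 t (cPhi (it i)).
      move=> s st; have sT := inT s t st tT; have s0 := proj1 (andP st).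
      by rewrite /Phi /= /Ft !partE// -/(x s) -/(xm s) mulr0 addr0.
    by split=> //; rewrite FE thE mxE YE//= mulr0 addr0.
have apriori (T : \bar R) : (forall t j, 0 <= t -> (t%:E < T)%E -> `|Y t j| <= B) ->
    forall t j, 0 <= t -> (t%:E < T)%E -> `|Y t j| <= C'.
  move=> /CL CLT t j t0 tT.
  have [xC xmC thC] := a_priori CLT xE xmE thE t0 tT.
  have CC' : C <= C' by rewrite (le_trans (ler_norm C))// /C' -!addrA lerDl !addr_ge0.
  case: j => [[i|i]|i].
  - have -> : Y t (inl (inl i)) = x t i 0 by rewrite mxE.
    by rewrite (le_trans (entry_le_norm _ _))// (le_trans xC).
  - have -> : Y t (inl (inr i)) = xm t i 0 by rewrite mxE.
    by rewrite (le_trans (entry_le_norm _ _))// (le_trans xmC).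
  - have -> : Y t (inr i) = th t i 0 by rewrite mxE.
    by rewrite (le_trans (entry_le_norm _ _))// (le_trans thC).
have Y0C j : `|Y 0 j| <= C'.
  rewrite Y0; case: j => [[i|i]|i] /=; rewrite ?rho0 ?mul0r ?addr0.
  - by rewrite (le_trans (entry_le_norm _ _))// /C' -!addrA addrCA lerDl !addr_ge0.
  - by rewrite (le_trans (entry_le_norm _ _))// /C' addrAC lerDr !addr_ge0.
  - by rewrite (le_trans (entry_le_norm _ _))// /C' lerDr !addr_ge0.
(* [Y] is [2 * K]-Lipschitz, so in a time [d] it moves by at most 1, the margin between [C'] and
   [B]. The bound [B] on [[0, k * d[] makes [Y] a true solution there, which improves the bound to
   [C'] and yields [B] again one step of length [d] further. *)
pose d := (2 * K + 1)^-1.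
have K1 : 0 < 2 * K + 1 by rewrite ltr_wpDl// mulr_ge0.
have d0 : 0 < d by rewrite invr_gt0.
have Kd : 2 * K * d <= 1 by rewrite ler_pdivrMr// mul1r lerDl.
have YB k : forall t j, 0 <= t -> (t%:E < (k%:R * d)%:E)%E -> `|Y t j| <= B.
  elim: k => [|k IH] t j t0; rewrite lte_fin.
    by rewrite mul0r ltNge t0.
  rewrite -natr1 mulrDl mul1r => tk.
  have near_le s : `|Y s j| <= C' -> `|t - s| <= d -> `|Y t j| <= B.
    move=> YsC ts; rewrite -[Y t j](subrK (Y s j)) addrC.
    rewrite (le_trans (ler_normD _ _))// lerD// (le_trans (Ylip _ _ _))//.
    by rewrite (le_trans _ Kd)// ler_wpM2l// mulr_ge0.
  have [td|dt] := leP t d.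
    by apply: (near_le 0) => //; rewrite subr0 ger0_norm.
  apply: (near_le (t - d)); last by rewrite opprB addrC subrK ger0_norm// ltW.
  apply: (apriori _ IH); first by rewrite subr_ge0 ltW.
  by rewrite lte_fin ltrBlDr.
exists x, xm, th; split=> //; apply: CL => t j t0 _.
apply: (YB (Num.bound (t / d))) => //.
by rewrite lte_fin -ltr_pdivrMr// archi_boundP// divr_ge0// ltW.
Qed.

End Existence.

Theorem theorem1 (R : realType) (n : nat) (Ap : 'M[R]_n) (b : 'cV[R]_n)
    (Am L Gamma P : 'M[R]_n) (r : R -> R) (theta_star : 'cV[R]_n)
    (hAm : hurwitz Am)
    (hAmbar : hurwitz (Am + L))
    (hGamma : sym_posdef Gamma)
    (hP : sym_posdef P)
    (hLyap : (Am + L)^T *m P + P *m (Am + L) = - 1%:M)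
    (hr : [bounded r t | t in (`[0, +oo[ : set R)])
    (hmatch : Am = Ap + b *m theta_star^T) :
  globally_stable Ap b Am L Gamma P r theta_star /\
  forall x xm theta : R -> 'cV[R]_n,
    closed_loop Ap b Am L Gamma P r +oo%E x xm theta ->
    x t - xm t @[t --> +oo%R] --> (0 : 'cV[R]_n).
Proof.
have [M M0 rM] : exists2 M : R, 0 <= M & forall t, 0 <= t -> `|r t| <= M.
  have [M [_ rM]] := hr; exists (`|M| + 1); first by rewrite addr_ge0.
  move=> t t0; apply: (rM (`|M| + 1)).
    by rewrite (le_lt_trans (ler_norm M))// ltrDl.
  by rewrite /= in_itv/= t0.
have bounded := uniform_boundedness hGamma hP hLyap hmatch hAm M0 rM.
split; last exact: error_vanishes hGamma hP hLyap hmatch hAm M M0 rM.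
split=> [eps eps0|//|mr x0 xm0 theta0].
  have [kappa k0 stab] := uniform_stability r hGamma hP hLyap hmatch.
  (* Halving turns the non-strict bound [kappa * delta] into the strict one required. *)
  exists (eps / 2 / kappa); first by rewrite !divr_gt0.
  move=> T x xm theta CL e0 th0 t t0 tT.
  have [] := stab _ _ _ _ _ CL (ltW e0) (ltW th0) t t0 tT.
  rewrite mulrC divfK ?gt_eqF// => et tht.
  by rewrite !(le_lt_trans et, le_lt_trans tht) ?gtr_pMr ?invf_lt1 ?ltr1n.
have [C CP] := bounded (`|x0| + `|xm0| + `|theta0|).
apply: (global_solution M0 rM mr (C := C)) => T x xm theta CL xE xmE thE t t0 tT.
have [|||xC xmC thC _] := CP T x xm theta CL _ _ _ t t0 tT; last by split.
- by rewrite xE -addrA lerDl addr_ge0.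
- by rewrite xmE addrAC lerDr addr_ge0.
- by rewrite thE lerDr addr_ge0.
Qed.
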